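(* Let $s\in(0,1)$. Let $\{a_n\}$ be a sequence of positive numbers such that $\sum_na_n^s<\infty$ and let $\{\lambda_n\}$ be a sequence in $\mathbb{T}$. Let $S_\mu$ be the singular inner function corresponding to $\mu=\sum_na_n\delta_{\lambda_n}$. Then there exists $g\in H^2\setminus\{0\}$ such that $S_\mu g\in\mathcal{D}_s$.
   Context: $\mathbb{D}$ is the open unit disc in $\mathbb{C}$, $\mathbb{T}$ the unit circle, $\delta_\lambda$ the unit point mass at $\lambda$, $H^2$ the Hardy space on $\mathbb{D}$, and $A$ normalized area measure on $\mathbb{D}$. For $s\in(0,1)$, $\mathcal{D}_s$ is the space of all holomorphic functions $f$ on $\mathbb{D}$ with $\|f\|_s^2:=\|f\|_{H^2}^2+\int_{\mathbb{D}}|f'(z)|^2(1-|z|^2)^s\,dA(z)<\infty$. For a positive finite Borel measure $\mu$ on $\mathbb{T}$ singular with respect to Lebesgue measure, $S_\mu(z)=\exp\left(-\int_{\mathbb{T}}\frac{w+z}{w-z}\,d\mu(w)\right)$. *)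

(* Defs.v *)
From mathcomp Require Import all_boot all_order all_algebra.
From mathcomp Require Import complex.
From mathcomp Require Import all_classical all_reals all_analysis.

Set Implicit Arguments.
Unset Strict Implicit.
Unset Printing Implicit Defensive.

Import Order.TTheory GRing.Theory Num.Theory.
Import numFieldNormedType.Exports.

Local Open Scope classical_set_scope.
Local Open Scope ring_scope.
Local Open Scope complex_scope.

Section Disc.
Context {R : realType}.

(* The norm of [R[i]] takes its values in [R[i]]; this is the same modulus,
   with values in [R]. *)
Definition modulus (z : R[i]) : R := complex.Re `|z|.

Definition expC (z : R[i]) : R[i] :=
  (expR (complex.Re z) * cos (complex.Im z)) +i*
  (expR (complex.Re z) * sin (complex.Im z)).

(* [R[i]] carries no measurable structure in the library; measures on the
   complex plane live on [R * R], whose product sigma-algebra is Borel.  A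
   measure on the unit circle is seen as a measure on the plane, integrated
   over the circle only. *)
Local Notation plane := (R * R)%type.

Definition to_plane (z : R[i]) : plane := (complex.Re z, complex.Im z).
Definition of_plane (p : plane) : R[i] := p.1 +i* p.2.

Definition disc : set R[i] := [set z | `|z| < 1].
Definition circle : set R[i] := [set z | `|z| = 1].

Definition holomorphic_on_disc (f : R[i] -> R[i]) : Prop :=
  forall z, disc z -> derivable (f : R[i]^o -> R[i]^o) z 1.

Definition cderive (f : R[i] -> R[i]) (z : R[i]) : R[i] :=
  'D_1 (f : R[i]^o -> R[i]^o) z.

Definition H2_sqnorm (f : R[i] -> R[i]) : \bar R :=
  ereal_sup [set ((2 * pi)^-1%:E *
      \int[lebesgue_measure]_(t in `[0%R, (2 * pi)%R])
        (modulus (f (r%:C * (cos t +i* sin t))) ^+ 2)%:E)%E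
    | r in [set r : R | 0 <= r < 1]].

Definition H2 (f : R[i] -> R[i]) : Prop :=
  holomorphic_on_disc f /\ (H2_sqnorm f < +oo)%E.

Definition area_integral (F : R[i] -> \bar R) : \bar R :=
  (pi^-1%:E * \int[(@lebesgue_measure R \x @lebesgue_measure R)%E]_(p in
     of_plane @^-1` disc) F (of_plane p))%E.

Definition Ds_sqnorm (s : R) (f : R[i] -> R[i]) : \bar R :=
  (H2_sqnorm f +
   area_integral (fun z =>
     (modulus (cderive f z) ^+ 2 * (1 - modulus z ^+ 2) `^ s)%:E))%E.

Definition Ds (s : R) (f : R[i] -> R[i]) : Prop :=
  holomorphic_on_disc f /\ (Ds_sqnorm s f < +oo)%E.

Definition circle_integral (mu : {measure set plane -> \bar R})
    (F : R[i] -> R[i]) : R[i] :=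
  Rintegral mu (of_plane @^-1` circle) (fun p => complex.Re (F (of_plane p))) +i*
  Rintegral mu (of_plane @^-1` circle) (fun p => complex.Im (F (of_plane p))).

Definition singular_inner (mu : {measure set plane -> \bar R})
    (z : R[i]) : R[i] :=
  expC (- circle_integral mu (fun w => (w + z) / (w - z))).

Definition atomic_measure (a : nat -> {posnum R}) (lambda : nat -> R[i]) :
    {measure set plane -> \bar R} :=
  mseries (fun n => mscale (a n)%:num%:nng (dirac (to_plane (lambda n)))) 0.

End Disc.

(* Main.v *)
(** With [w_n = 1 - conj(lambda_n) z], the singular inner function is [exp (- G)],
    [G = sum a_n (2 / w_n - 1)], and one takes for [g] the product of the functions
    [w_n / (a_n + w_n)], which are bounded by 1 and vanish at [lambda_n] on the
    scale [a_n].  The logarithmic derivative of [f = exp (- G) g] is bounded by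
    [3 T], [T = sum a_n / |w_n|^2].  By Cauchy-Schwarz [T^2 <= U V] with
    [U = sum a_n Re w_n / |w_n|^2] and [V = sum a_n / (Re w_n |w_n|^2)].  Since
    [Re G = 2 U - sum a_n], the factor [|exp (- G)|^2] absorbs [U], and
    [|g|^2] turns [V] into [W = sum a_n / (Re w_n |a_n + w_n|^2)], so that
    [|f'|^2 <= C W].  Finally each term of [W], weighted by [(1 - |z|^2)^s], has an
    area integral at most [C a_n^s]: cut the disc into dyadic strips
    [al < Re w_n <= 2 al], [al = a_n 2^k] with [k] an integer, on which the integral
    is computed by Tonelli. *)

Require Import Defs.
From mathcomp Require Import all_boot all_order all_algebra.
From mathcomp Require Import complex ring lra.
From mathcomp Require Import all_classical all_reals all_analysis measurable_realfun.

Set Implicit Arguments.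
Unset Strict Implicit.
Unset Printing Implicit Defensive.

Import Order.TTheory GRing.Theory Num.Theory.
Import numFieldNormedType.Exports.
Local Open Scope classical_set_scope.
Local Open Scope ring_scope.
Local Open Scope complex_scope.

(** * Second-order complex differentiability *)

(** For [g = 1] the same method leads to the kernel [1 / (Re w_n |w_n|^2)], whose strip bounds, of
    order [al^s / al], are not summable as [al] tends to 0 because [s < 1]. Putting [a_n + w_n] into
    the square moves the pole to [(1 + a_n) lambda_n], at distance [a_n] from the disc. The strip
    bound becomes [al^s / (a_n + al)], which behaves like [al^s / a_n] below the scale [a_n]
    (summable as [s > 0]) and like [al^s / al] above it (summable as [s < 1]). Both tails are
    geometric, of total order [a_n^s / a_n], and the coefficient [a_n] in [W] leaves [a_n^s]. The
    infinite product exists because its factors differ from 1 by [a_n / (a_n + w_n)], and [sum a_n]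
    converges along with [sum a_n^s]. Holomorphy of the infinite sum and product is obtained by
    carrying an explicit quadratic remainder through the partial sums and products: its constant and
    radius depend only on [1 - |z|] and [sum a_n], so it survives the limit. *)

Lemma quadratic_is_derive (K : numFieldType) (C r : K) (f : K^o -> K^o)
    (z v : K^o) : 0 <= C -> 0 < r ->
  (forall h : K, `|h| < r -> `|f (z + h) - f z - h * v| <= C * `|h| ^+ 2) ->
  is_derive z 1 f v.
Proof.
move=> C0 r0 H.
have C1 : 0 < C + 1 by rewrite ltr_wpDl.
have cv : (h^-1 *: ((f \o shift z) (h *: 1) - f z)) @[h --> 0^'] --> v.
  apply/cvgrPdist_lt => e e0; near=> h.
  have hr : `|h| < r.
    near: h; apply: (@cvg_within _ (nbhs (0 : K))).
    by have := @nbhs0_lt _ K^o r r0; apply.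
  have he : `|h| < e / (C + 1).
    near: h; apply: (@cvg_within _ (nbhs (0 : K))).
    by have := @nbhs0_lt _ K^o (e / (C + 1)) (divr_gt0 e0 C1); apply.
  have h0 : h != 0 by near: h; exact: nbhs_dnbhs_neq.
  rewrite /= [in h *: _]/GRing.scale/= mulr1 [h + z]addrC.
  have -> : v - h^-1 *: (f (z + h) - f z) = - (h^-1 * (f (z + h) - f z - h * v)).
    set D := f (z + h) - f z.
    by rewrite mulrBr [h^-1 * (h * v)]mulrA mulVf// mul1r opprB.
  rewrite normrN normrM normfV mulrC ltr_pdivrMr ?normr_gt0//.
  apply: (le_lt_trans (H _ hr)).
  rewrite expr2 mulrA ltr_pM2r ?normr_gt0//.
  move: he; rewrite ltr_pdivlMr// => he.
  by apply: le_lt_trans he; rewrite mulrC ler_wpM2l// lerDl.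
apply: DeriveDef.
  by apply/cvg_ex; exists v.
exact/cvg_lim.
Unshelve. all: by end_near. Qed.

Section ComplexCalculus.
Context {R : realType}.
Implicit Types (z w h v : R[i]) (C r : R).

Lemma modulusE z : modulus z = Num.sqrt (complex.Re z ^+ 2 + complex.Im z ^+ 2).
Proof. by case: z. Qed.

Lemma normr_modulus z : `|z| = (modulus z)%:C.
Proof. by case: z. Qed.

Lemma modulus_ge0 z : 0 <= modulus z.
Proof. by rewrite modulusE sqrtr_ge0. Qed.

Lemma modulusM z w : modulus (z * w) = modulus z * modulus w.
Proof. exact: ComplexField.Normc.normcM. Qed.

Lemma modulusN z : modulus (- z) = modulus z.
Proof. exact: normcN. Qed.

Lemma modulusV z : modulus z^-1 = (modulus z)^-1.
Proof. exact: ComplexField.Normc.normcV. Qed.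

Lemma modulusD z w : modulus (z + w) <= modulus z + modulus w.
Proof. exact: le_normcD. Qed.

Lemma modulus0 : modulus (0 : R[i]) = 0.
Proof. exact: ComplexField.Normc.normc0. Qed.

Lemma modulus_eq0 z : (modulus z == 0) = (z == 0).
Proof.
apply/eqP/eqP => [|->]; [exact: ComplexField.Normc.eq0_normc|exact: modulus0].
Qed.

Lemma modulus1 : modulus (1 : R[i]) = 1.
Proof. exact: ComplexField.Normc.normc1. Qed.

Lemma sqr_modulus z : modulus z ^+ 2 = complex.Re z ^+ 2 + complex.Im z ^+ 2.
Proof. by rewrite modulusE sqr_sqrtr// addr_ge0 ?sqr_ge0. Qed.

Lemma modulus_real r : modulus r%:C = `|r|.
Proof. by rewrite modulusE/= expr0n addr0 sqrtr_sqr. Qed.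

Lemma normr_Re_le z : `|complex.Re z| <= modulus z.
Proof.
by rewrite -sqrtr_sqr modulusE ler_wsqrtr// lerDl sqr_ge0.
Qed.

Lemma normr_Im_le z : `|complex.Im z| <= modulus z.
Proof.
by rewrite -sqrtr_sqr modulusE ler_wsqrtr// lerDr sqr_ge0.
Qed.

Lemma modulus_le_ReIm z : modulus z <= `|complex.Re z| + `|complex.Im z|.
Proof.
rewrite -(@ler_pXn2r _ 2) ?nnegrE ?modulus_ge0 ?addr_ge0//.
rewrite sqr_modulus sqrrD !real_normK ?num_real// lerD2r lerDl.
by rewrite mulrn_wge0// mulr_ge0.
Qed.

Lemma discE z : disc z <-> modulus z < 1.
Proof. by rewrite /disc/= normr_modulus (ltcR _ 1). Qed.

Lemma circleE z : circle z <-> modulus z = 1.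
Proof.
by rewrite /circle/= normr_modulus; split=> [[]|->].
Qed.

(* A complex derivative with a quadratic remainder; unlike plain differentiability
   this passes to pointwise limits as soon as [C] and [r] are uniform. *)
Definition approx2 C r (f : R[i] -> R[i]) z v :=
  forall h, modulus h < r ->
    modulus (f (z + h) - f z - h * v) <= C * modulus h ^+ 2.

Lemma approx2_is_derive C r f z v : 0 < r -> approx2 C r f z v ->
  @is_derive _ R[i]^o R[i]^o z 1 (f : R[i]^o -> R[i]^o) v.
Proof.
move=> r0 H; apply: (@quadratic_is_derive R[i] `|C|%:C r%:C).
- by rewrite ler0c.
- by rewrite (ltcR 0).
- move=> h; rewrite !normr_modulus ltcR -rmorphXn -rmorphM lecR => /H /le_trans.
  by apply; rewrite ler_wpM2r ?ler_norm// exprn_ge0// modulus_ge0.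
Qed.

End ComplexCalculus.

(** * Limits of complex sequences, taken coordinatewise *)

Section ComplexLimits.
Context {R : realType}.
Implicit Types (u v : nat -> R[i]) (l m z : R[i]).

Definition cvgC u l :=
  (fun n => complex.Re (u n)) @ \oo --> complex.Re l /\
  (fun n => complex.Im (u n)) @ \oo --> complex.Im l.

(** Where a coordinate diverges this is the default value of [limn]. [herglotz], [zprod] and their
    derivatives are defined through it and are shown to be genuine limits on the disc. *)
Definition limC u : R[i] :=
  limn (fun n => complex.Re (u n)) +i* limn (fun n => complex.Im (u n)).

Lemma Re_addc z l : complex.Re (z + l) = complex.Re z + complex.Re l.
Proof. by case: z; case: l. Qed.
Lemma Im_addc z l : complex.Im (z + l) = complex.Im z + complex.Im l.
Proof. by case: z; case: l. Qed.
Lemma Re_oppc z : complex.Re (- z) = - complex.Re z.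
Proof. by case: z. Qed.
Lemma Im_oppc z : complex.Im (- z) = - complex.Im z.
Proof. by case: z. Qed.
Lemma Re_mulc z l : complex.Re (z * l) =
  complex.Re z * complex.Re l - complex.Im z * complex.Im l.
Proof. by case: z; case: l. Qed.
Lemma Im_mulc z l : complex.Im (z * l) =
  complex.Re z * complex.Im l + complex.Im z * complex.Re l.
Proof. by case: z; case: l. Qed.

Lemma cvgC_cst l : cvgC (fun=> l) l.
Proof. by split; exact: cvg_cst. Qed.

Lemma cvgCD u v l m : cvgC u l -> cvgC v m -> cvgC (fun n => u n + v n) (l + m).
Proof.
move=> [u1 u2] [v1 v2]; split.
- by rewrite Re_addc; under eq_fun do rewrite Re_addc; exact: cvgD.
- by rewrite Im_addc; under eq_fun do rewrite Im_addc; exact: cvgD.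
Qed.

Lemma cvgCN u l : cvgC u l -> cvgC (fun n => - u n) (- l).
Proof.
move=> [u1 u2]; split.
- by rewrite Re_oppc; under eq_fun do rewrite Re_oppc; exact: cvgN.
- by rewrite Im_oppc; under eq_fun do rewrite Im_oppc; exact: cvgN.
Qed.

Lemma cvgCM u v l m : cvgC u l -> cvgC v m -> cvgC (fun n => u n * v n) (l * m).
Proof.
move=> [u1 u2] [v1 v2]; split.
- rewrite Re_mulc; under eq_fun do rewrite Re_mulc.
  by apply: cvgB; exact: cvgM.
- rewrite Im_mulc; under eq_fun do rewrite Im_mulc.
  by apply: cvgD; exact: cvgM.
Qed.

Lemma cvgC_modulus u l : cvgC u l -> modulus (u n) @[n --> \oo] --> modulus l.
Proof.
move=> [u1 u2]; rewrite modulusE; under eq_fun do rewrite modulusE.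
have : (fun n => complex.Re (u n) ^+ 2 + complex.Im (u n) ^+ 2) @ \oo -->
    complex.Re l ^+ 2 + complex.Im l ^+ 2.
  under eq_fun do rewrite 2!expr2; rewrite 2!expr2.
  by apply: cvgD; exact: cvgM.
by move=> /cvg_comp; apply; exact: sqrt_continuous.
Qed.

Lemma cvgC_modulus_le u l c : cvgC u l -> (forall n, modulus (u n) <= c) ->
  modulus l <= c.
Proof.
move=> /cvgC_modulus ul uc.
rewrite -(cvg_lim (@Rhausdorff R) ul); apply: limr_le; first exact: cvgP ul.
exact: nearW.
Qed.

(** The telescoping series of [x] is dominated by [b], hence absolutely convergent. Stated on
    increments, it covers partial sums and partial products alike. *)
Lemma cvgn_increments (x b : nat -> R) :
  (forall n, `|x n.+1 - x n| <= b n) -> cvgn (series b) -> cvgn x.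
Proof.
move=> xb cb.
have : cvgn (series (telescope x)).
  apply: normed_cvg; apply: series_le_cvg cb => n //=.
    by apply: le_trans (xb n).
  exact: xb.
move=> cx; have -> : x = (fun n => series (telescope x) n) + (fun=> x 0%N).
  by apply/funext => n; rewrite fctE addrC -eq_sum_telescope.
by apply: is_cvgD => //; exact: is_cvg_cst.
Qed.

Lemma cvgC_increments u b :
  (forall n, modulus (u n.+1 - u n) <= b n) -> cvgn (series b) ->
  cvgC u (limC u).
Proof.
move=> ub cb; split; apply: cvgn_increments cb => n; apply: le_trans (ub n).
- by rewrite -Re_oppc -Re_addc normr_Re_le.
- by rewrite -Im_oppc -Im_addc normr_Im_le.
Qed.

Lemma cvgC_limC u l : cvgC u l -> limC u = l.
Proof.
case: l => x y [/= /(cvg_lim (@Rhausdorff R)) h1 /(cvg_lim (@Rhausdorff R)) h2].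
by rewrite /limC h1 h2.
Qed.

(** For a fixed [h] the remainder is a continuous expression in three numbers, the values at [z + h]
    and [z] and the derivative [v n], so the inequality passes to the limit for each [h]
    separately. *)
Lemma approx2_limit C r (f : nat -> R[i] -> R[i]) (v : nat -> R[i]) F V z :
  0 < r ->
  (forall h, modulus h < r -> cvgC (f ^~ (z + h)) (F (z + h))) -> cvgC v V ->
  (forall n, approx2 C r (f n) z (v n)) -> approx2 C r F z V.
Proof.
move=> r0 fF vV H h hr.
have fz : cvgC (f ^~ z) (F z).
  by rewrite -[z]addr0; apply: fF; rewrite modulus0.
apply: (@cvgC_modulus_le (fun n => f n (z + h) - f n z - h * v n)).
  apply: cvgCD; first by apply: cvgCD; [exact: fF|exact: cvgCN].
  by apply: cvgCN; apply: cvgCM => //; exact: cvgC_cst.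
by move=> n; exact: H.
Qed.

End ComplexLimits.

(** * Taylor remainders of sine, cosine and the exponential *)

Section RealEstimates.
Context {R : realType}.
Implicit Types x y : R.

Lemma normr_sin_le x : `|sin x| <= `|x|.
Proof.
wlog x0 : x / 0 <= x => [H|].
  have [/H//|/ltW x0] := leP 0 x.
  by rewrite -normrN -sinN -(normrN x) H// oppr_ge0.
have [c _] := @MVT_segment R sin cos 0 x x0 (fun y _ => is_derive_sin y)
  (continuous_subspaceT (@continuous_sin R)).
rewrite sin0 !subr0 => ->; rewrite normrM ler_piMl//.
by rewrite ler_norml cos_geN1 cos_le1.
Qed.

Lemma norm_cosB1_le x : `|cos x - 1| <= x ^+ 2.
Proof.
have -> : cos x - 1 = - (2 * sin (x / 2) ^+ 2).
  have -> : cos x = cos ((x / 2) *+ 2) by congr cos; rewrite -mulr_natr; field.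
  by rewrite cos_mulr2n sin2cos2; ring.
rewrite normrN normrM normrX ger0_norm//.
have := normr_sin_le (x / 2).
rewrite -(@ler_pXn2r _ 2) ?nnegrE// => h.
apply: (@le_trans _ _ (2 * `|x / 2| ^+ 2)); first by rewrite ler_wpM2l.
rewrite real_normK ?num_real//.
have := sqr_ge0 x; nra.
Qed.

Lemma norm_sinB_le x : `|x| <= 1 -> `|sin x - x| <= x ^+ 2.
Proof.
wlog x0 : x / 0 <= x => [H|].
  have [/H//|/ltW x0 x1] := leP 0 x.
  have -> : sin x - x = - (sin (- x) - - x) by rewrite sinN; ring.
  by rewrite normrN -(sqrrN x) H ?oppr_ge0// normrN.
rewrite ger0_norm// => x1.
have [c] := @MVT_segment R sin cos 0 x x0 (fun y _ => is_derive_sin y)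
  (continuous_subspaceT (@continuous_sin R)).
rewrite in_itv/= sin0 !subr0 => /andP[c0 cx] ->.
have -> : cos c * x - x = (cos c - 1) * x by ring.
rewrite normrM (ger0_norm x0) expr2 ler_wpM2r//.
apply: (le_trans (norm_cosB1_le c)); nra.
Qed.

(** The upper bound comes from [exp (-x) >= 1 - x], that is [exp x (1 - x) <= 1]: multiplying the
    claim by [1 - x > 0], it remains to see that [1 - (1 + x + 2 x^2) (1 - x) = - x^2 (1 - 2 x)] is
    at most 0, which is where [x <= 1/2] enters. *)
Lemma norm_expRB1D_le x : `|x| <= 2^-1 -> `|expR x - 1 - x| <= 2 * x ^+ 2.
Proof.
rewrite ler_norml => /andP[xl xu].
have h1 := expR_ge1Dx x; have h2 := expR_ge1Dx (- x).
have h3 : expR x * expR (- x) = 1 by rewrite expRN mulfV// gt_eqF// expR_gt0.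
have := expR_gt0 x; move: h1 h2 h3.
set e := expR x; set e' := expR _ => h1 h2 h3 e0.
have h4 : e * (1 - x) <= 1 by nra.
have h5 : (e - 1 - x - 2 * x ^+ 2) * (1 - x) <= 0 by nra.
have h6 : e - 1 - x - 2 * x ^+ 2 <= 0.
  by rewrite leNgt; apply/negP => h7; nra.
by rewrite ger0_norm; lra.
Qed.

End RealEstimates.

Section ComplexDerivative.
Context {R : realType}.
Implicit Types (z w h v k : R[i]) (C r : R).

Lemma expCD z w : expC (z + w) = expC z * expC w.
Proof.
case: z w => [x y] [x' y']; rewrite /expC/=; apply/eqP; rewrite eq_complex/=.
by rewrite expRD cosD sinD; apply/andP; split; apply/eqP; ring.
Qed.

Lemma modulus_expC z : modulus (expC z) = expR (complex.Re z).
Proof.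
rewrite modulusE /expC/= !exprMn -mulrDr cos2Dsin2 mulr1 sqrtr_sqr.
by rewrite ger0_norm// expR_ge0.
Qed.

(** With [k = x + iy], the real and imaginary parts of the remainder are at most 2 and 3 times
    [x^2 + y^2], by the three real estimates; hence the 5. *)
Lemma modulus_expCB1_le k : modulus k <= 2^-1 ->
  modulus (expC k - 1 - k) <= 5 * modulus k ^+ 2.
Proof.
case: k => x y k2.
have x2 : `|x| <= 2^-1 by apply: le_trans k2; exact: (normr_Re_le (x +i* y)).
have y2 : `|y| <= 2^-1 by apply: le_trans k2; exact: (normr_Im_le (x +i* y)).
have y1 : `|y| <= 1 by lra.
rewrite sqr_modulus/=; apply: (le_trans (modulus_le_ReIm _)).
rewrite !Re_addc !Im_addc !Re_oppc !Im_oppc /= subr0.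
have := norm_cosB1_le y; have := norm_sinB_le y1; have := norm_expRB1D_le x2.
move: x2 y2; rewrite !ler_norml.
have := expR_gt0 x.
set e := expR x; set c := cos y; set s := sin y.
move=> e0 /andP[x1 x2] /andP[y3 y4] /andP[e1 e2] /andP[s1 s2] /andP[c1 c2].
have e3 : e <= 2 by nra.
have e4 : `|e - 1| <= 1 by rewrite ler_norml; apply/andP; split; nra.
have A : `|e * c - 1 - x| <= 2 * x ^+ 2 + 2 * y ^+ 2.
  have -> : e * c - 1 - x = (e - 1 - x) + e * (c - 1) by ring.
  apply: (le_trans (ler_normD _ _)); apply: lerD.
    by rewrite ler_norml e1 e2.
  by rewrite normrM gtr0_norm// ler_pM// ?(ltW e0)// ler_norml c1 c2.
have B : `|e * s - y| <= 3 * x ^+ 2 + 3 * y ^+ 2.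
  have -> : e * s - y = e * (s - y) + (e - 1 - x) * y + x * y by ring.
  have B1 : `|e * (s - y)| <= 2 * y ^+ 2.
    by rewrite normrM gtr0_norm// ler_pM// ?(ltW e0)// ler_norml s1 s2.
  have B2 : `|(e - 1 - x) * y| <= x ^+ 2.
    rewrite normrM (le_trans (ler_pM _ _ (_ : _ <= 2 * x ^+ 2) (_ : _ <= 2^-1)))//.
    - by rewrite ler_norml e1 e2.
    - by rewrite ler_norml y3 y4.
    - by rewrite mulrC mulrA mulVf// mul1r.
  have B3 : `|x * y| <= x ^+ 2 + y ^+ 2.
    by rewrite ler_norml; apply/andP; split; nra.
  apply: (le_trans (ler_normD _ _)).
  apply: (le_trans (lerD (ler_normD _ _) (lexx _))); lra.
lra.
Qed.

(** The constants are hidden here because a product or an exponential only needs some constants;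
    [approx2] keeps them visible for limits, where they must be uniform. *)
Definition quad_derive (f : R[i] -> R[i]) z v :=
  exists C r, [/\ 0 <= C, 0 < r & approx2 C r f z v].

Lemma quad_derive_is_derive f z v : quad_derive f z v ->
  @is_derive _ R[i]^o R[i]^o z 1 (f : R[i]^o -> R[i]^o) v.
Proof. by move=> [C [r [_ r0 H]]]; exact: approx2_is_derive H. Qed.

Lemma approx2_increment C r f z v h : 0 <= C -> approx2 C r f z v ->
  modulus h < r -> modulus h <= 1 ->
  modulus (f (z + h) - f z) <= (modulus v + C) * modulus h.
Proof.
move=> C0 H hr h1.
have -> : f (z + h) - f z = (f (z + h) - f z - h * v) + h * v by rewrite subrK.
apply: (le_trans (modulusD _ _)); rewrite modulusM.
have := H _ hr; have := modulus_ge0 h; have := modulus_ge0 v.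
move: (modulus (_ - _)) (modulus h) (modulus v) h1 => A B D B1 D0 B0 AB.
have : C * B ^+ 2 <= C * B by rewrite ler_wpM2l// expr2 ler_piMl.
lra.
Qed.

Lemma quad_deriveM f g z v w : quad_derive f z v -> quad_derive g z w ->
  quad_derive (fun x => f x * g x) z (v * g z + f z * w).
Proof.
move=> [C [r [C0 r0 H]]] [C' [r' [C'0 r'0 H']]].
exists (C * (modulus (g z) + modulus w + C') + modulus (f z) * C' +
  modulus v * (modulus w + C')), (Num.min (Num.min r r') 1).
have fz := modulus_ge0 (f z); have gz := modulus_ge0 (g z).
have v0 := modulus_ge0 v; have w0 := modulus_ge0 w.
split; first by rewrite !addr_ge0// mulr_ge0// !addr_ge0.
  by rewrite !lt_min r0 r'0/=.
move=> h; rewrite !lt_min => /andP[/andP[hr hr'] /ltW h1].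
(* Product rule on remainders: the three terms are quadratic in [h], the last one because the
   increment of [g] is linear in [|h|] for [|h| <= 1]. The constant given above collects their three
   bounds. *)
have -> : f (z + h) * g (z + h) - f z * g z - h * (v * g z + f z * w) =
  (f (z + h) - f z - h * v) * (g z + (g (z + h) - g z)) +
  f z * (g (z + h) - g z - h * w) + h * v * (g (z + h) - g z) by ring.
have Ef := H _ hr; have Eg := H' _ hr'.
have Dg := approx2_increment C'0 H' hr' h1.
have h0 := modulus_ge0 h.
apply: (le_trans (modulusD _ _)); apply: (le_trans (lerD (modulusD _ _) (lexx _))).
rewrite !modulusM.
have Dg' := modulusD (g z) (g (z + h) - g z).
have := modulus_ge0 (g (z + h) - g z); have := modulus_ge0 (f (z + h) - f z - h * v).
move: (modulus (g z + _)) (modulus (f _ - _ - _)) Dg' Ef Eg Dg => A B.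
move: (modulus (g _ - _ - _)) (modulus (g _ - _)) => D E.
move: h1 h0 fz gz v0 w0.
move: (modulus h) (modulus (f z)) (modulus (g z)) (modulus v) (modulus w).
move=> eta F G V W eta1 eta0 F0 G0 V0 W0 AE BC DC EW B0 E0.
have A1 : A <= G + W + C'.
  apply: (le_trans AE); rewrite -addrA lerD2l.
  by apply: (le_trans EW); rewrite ler_piMr// addr_ge0.
have A2 : B * A <= (C * eta ^+ 2) * (G + W + C').
  rewrite (le_trans (ler_wpM2l B0 A1))// ler_wpM2r// !addr_ge0//.
have A3 : F * D <= F * (C' * eta ^+ 2) by rewrite ler_wpM2l.
have A4 : eta * V * E <= eta * V * ((W + C') * eta).
  by rewrite ler_wpM2l// mulr_ge0.
lra.
Qed.

Lemma quad_derive_expC f z v : quad_derive f z v ->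
  quad_derive (fun x => expC (f x)) z (expC (f z) * v).
Proof.
move=> [C [r [C0 r0 H]]].
have v0 := modulus_ge0 v.
set D := modulus v + C; have D0 : 0 <= D by rewrite addr_ge0.
(* [D] is a Lipschitz constant of [f] at [z]; the radius [1 / (2 (D + 1))] keeps the increment [k]
   of [f] within [1/2], the range of [modulus_expCB1_le]. *)
exists (modulus (expC (f z)) * (5 * D ^+ 2 + C)),
  (Num.min (Num.min r 1) (2 * (D + 1))^-1).
have e0 := modulus_ge0 (expC (f z)).
split.
- by apply: mulr_ge0 => //; have := sqr_ge0 D; lra.
- by rewrite !lt_min r0/= ltr01 invr_gt0; lra.
move=> h; rewrite !lt_min => /andP[/andP[hr /ltW h1] hD].
have h0 := modulus_ge0 h.
set k := f (z + h) - f z.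
have kD : modulus k <= D * modulus h by exact: (approx2_increment C0 H hr h1).
have k0 := modulus_ge0 k.
have k2 : modulus k <= 2^-1.
  apply: (le_trans kD); move: hD.
  have D1 : 0 < 2 * (D + 1) by lra.
  by rewrite -[_^-1]mul1r ltr_pdivlMr// => hD; lra.
have -> : expC (f (z + h)) - expC (f z) - h * (expC (f z) * v) =
    expC (f z) * ((expC k - 1 - k) + (k - h * v)).
  have -> : f (z + h) = f z + k by rewrite /k; ring.
  by rewrite expCD; ring.
rewrite modulusM -mulrA ler_wpM2l//.
apply: (le_trans (modulusD _ _)); rewrite mulrDl; apply: lerD; last exact: H.
apply: (le_trans (modulus_expCB1_le k2)); rewrite -mulrA ler_wpM2l//.
by rewrite -exprMn ler_pXn2r ?nnegrE// mulr_ge0.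
Qed.

End ComplexDerivative.

(** * Explicit remainders of sums, products and inverses *)

Section Approx2Algebra.
Context {R : realType}.
Implicit Types (f : R[i] -> R[i]) (z v l c : R[i]) (C r : R).

Lemma modulus_sum n (F : nat -> R[i]) :
  modulus (\sum_(i < n) F i) <= \sum_(i < n) modulus (F i).
Proof.
elim: n => [|n IH]; first by rewrite !big_ord0 modulus0.
by rewrite !big_ord_recr/= (le_trans (modulusD _ _))// lerD2r.
Qed.

Lemma modulus_prod n (F : nat -> R[i]) :
  modulus (\prod_(i < n) F i) = \prod_(i < n) modulus (F i).
Proof.
by apply: (big_morph (@modulus R)); [exact: modulusM|exact: modulus1].
Qed.

Lemma approx2_sum r n (C : nat -> R) (f : nat -> R[i] -> R[i]) z (v : nat -> R[i]) :
  (forall i, approx2 (C i) r (f i) z (v i)) ->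
  approx2 (\sum_(i < n) C i) r (fun x => \sum_(i < n) f i x) z (\sum_(i < n) v i).
Proof.
move=> H h hr; rewrite mulr_suml mulr_sumr -!sumrB.
apply: (le_trans (modulus_sum _ (fun i => f i (z + h) - f i z - h * v i))).
by apply: ler_sum => i _; exact: H.
Qed.

Lemma approx2_affine C r c c' f z v : approx2 C r f z v ->
  approx2 (modulus c * C) r (fun x => c * f x + c') z (c * v).
Proof.
move=> H h hr.
have -> : c * f (z + h) + c' - (c * f z + c') - h * (c * v) =
  c * (f (z + h) - f z - h * v) by ring.
by rewrite modulusM -mulrA ler_wpM2l ?modulus_ge0//; exact: H.
Qed.

(* [D m] is the derivative of the product of the first [m] factors, given by the
   Leibniz recursion. *)
Lemma approx2_prod r n (B : R) (b : nat -> R) (g : nat -> R[i] -> R[i]) z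
    (g' : nat -> R[i]) :
  0 < r <= 1 ->
  (forall i h, modulus h < r -> modulus (g i (z + h)) <= 1) ->
  (forall i, modulus (g' i) <= b i) ->
  (forall i, approx2 (b i) r (g i) z (g' i)) ->
  (forall m, \sum_(i < m) b i <= B) ->
  forall D : nat -> R[i], D 0%N = 0 ->
  (forall m, D m.+1 = D m * g m z + (\prod_(i < m) g i z) * g' m) ->
  approx2 (B * (1 + 2 * B)) r (fun x => \prod_(i < n) g i x) z (D n).
Proof.
move=> /andP[r0 r1] g1 g'b gapp bB D D0 DS.
have b0 i : 0 <= b i by apply: le_trans (g'b i); exact: modulus_ge0.
have prod1 m h : modulus h < r -> modulus (\prod_(i < m) g i (z + h)) <= 1.
  move=> hr; rewrite (@modulus_prod m (fun i => g i (z + h))).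
  by apply: prodr_ile1 => i _; rewrite modulus_ge0/=; exact: g1.
have B0 : 0 <= B by have := bB 0%N; rewrite big_ord0.
have g1z i : modulus (g i z) <= 1 by rewrite -[z]addr0 g1// modulus0.
have prod1z m : modulus (\prod_(i < m) g i z) <= 1.
  by have := prod1 m 0; rewrite addr0 modulus0; apply.
(* As all factors and partial products have modulus at most 1, the Leibniz recursion adds at most
   [b m] at each step. *)
have DB m : modulus (D m) <= B.
  apply: le_trans (bB m); elim: m => [|m IH]; first by rewrite D0 modulus0 big_ord0.
  rewrite DS big_ord_recr/= (le_trans (modulusD _ _))// !modulusM lerD//.
    by rewrite -[leRHS]mulr1; apply: ler_pM; rewrite ?modulus_ge0 ?g1z.
  by rewrite -[leRHS]mul1r; apply: ler_pM; rewrite ?modulus_ge0 ?prod1z.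
move=> h hr; have h0 := modulus_ge0 h.
suff : modulus (\prod_(i < n) g i (z + h) - \prod_(i < n) g i z - h * D n) <=
    (\sum_(i < n) b i) * (1 + 2 * B) * modulus h ^+ 2.
  move=> /le_trans; apply; rewrite -2!mulrA ler_wpM2r// mulr_ge0 ?sqr_ge0//.
  by rewrite addr_ge0// mulr_ge0.
elim: n => [|n IH].
  by rewrite !big_ord0 D0 mulr0 subr0 subrr modulus0 !mul0r.
rewrite !big_ord_recr/= DS.
set P := \prod_(i < n) g i z; set P' := \prod_(i < n) g i (z + h).
(* The first term carries the previous remainder, not amplified since [|g n| <= 1]. The second costs
   [b n], and the third [2 B b n] because the increment of [g n] is at most [2 b n |h|]. Each factor
   thus adds [b n (1 + 2 B)], which explains the constant. *)
have -> : P' * g n (z + h) - P * g n z - h * (D n * g n z + P * g' n) =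
  (P' - P - h * D n) * g n (z + h) + P * (g n (z + h) - g n z - h * g' n) +
  h * D n * (g n (z + h) - g n z) by ring.
apply: (le_trans (modulusD _ _)); apply: (le_trans (lerD (modulusD _ _) (lexx _))).
rewrite !modulusM -/P -/P' in IH *.
have h1 : modulus h <= 1 by rewrite (le_trans (ltW hr)).
have T1 : modulus (P' - P - h * D n) * modulus (g n (z + h)) <=
    (\sum_(i < n) b i) * (1 + 2 * B) * modulus h ^+ 2.
  by rewrite -[leRHS]mulr1; apply: ler_pM; rewrite ?modulus_ge0 ?g1.
have T2 : modulus P * modulus (g n (z + h) - g n z - h * g' n) <= b n * modulus h ^+ 2.
  by rewrite -[leRHS]mul1r; apply: ler_pM; rewrite ?modulus_ge0 ?prod1z ?gapp.
have T3 : modulus h * modulus (D n) * modulus (g n (z + h) - g n z) <=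
    modulus h * B * (2 * b n * modulus h).
  apply: ler_pM; rewrite ?modulus_ge0 ?mulr_ge0 ?modulus_ge0//.
    by rewrite ler_wpM2l.
  apply: (le_trans (approx2_increment (b0 n) (gapp n) hr h1)).
  by rewrite ler_wpM2r// mulr_natl mulr2n lerD2r.
lra.
Qed.

(** With [w = b + 1 - l z], the remainder is exactly [(l h)^2 / (w^2 (w - l h))]; for [|h| < d / 2]
    the denominator is at least [d^2 (d / 2)]. *)
Lemma approx2_inv d z l (b : R) : 0 < d -> modulus l = 1 ->
  d <= modulus (b%:C + (1 - l * z)) ->
  approx2 (2 / d ^+ 3) (d / 2) (fun x => (b%:C + (1 - l * x))^-1) z
    (l / (b%:C + (1 - l * z)) ^+ 2).
Proof.
move=> d0 l1; set w := b%:C + _ => dw h hd.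
have -> : b%:C + (1 - l * (z + h)) = w - l * h by rewrite /w; ring.
have lh : modulus (l * h) = modulus h by rewrite modulusM l1 mul1r.
have w0 : w != 0 by rewrite -modulus_eq0 gt_eqF// (lt_le_trans d0).
have dw' : d / 2 <= modulus (w - l * h).
  have := modulusD (w - l * h) (l * h); rewrite subrK lh; lra.
have w'0 : w - l * h != 0.
  by rewrite -modulus_eq0 gt_eqF// (lt_le_trans _ dw')// divr_gt0.
have -> : (w - l * h)^-1 - w^-1 - h * (l / w ^+ 2) =
    (l * h) ^+ 2 * (w ^- 2 * (w - l * h)^-1) by field; apply/andP.
rewrite expr2 !modulusM l1 !mul1r -expr2 mulrC ler_wpM2r ?sqr_ge0//.
rewrite !modulusV expr2 modulusM -expr2.
have -> : 2 / d ^+ 3 = d ^- 2 * (d / 2)^-1 by field; rewrite gt_eqF.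
have d20 : 0 < d / 2 by rewrite divr_gt0.
apply: ler_pM; rewrite ?invr_ge0 ?sqr_ge0 ?modulus_ge0//.
- rewrite lef_pV2 ?posrE ?exprn_gt0// ?(lt_le_trans d0 dw)//.
  by rewrite ler_pXn2r ?nnegrE ?modulus_ge0// ltW.
- by rewrite lef_pV2 ?posrE// (lt_le_trans d20 dw').
Qed.

End Approx2Algebra.

(** * The factors attached to the atoms *)

Section DiscFactors.
Context {R : realType}.
Implicit Types (z l h : R[i]) (b : R).

Definition wfac l z : R[i] := 1 - l^* * z.

Definition pole_kernel b l z : R :=
  (complex.Re (wfac l z) * modulus (b%:C + wfac l z) ^+ 2)^-1.

Lemma modulusJ l : modulus l^* = modulus l.
Proof. by rewrite !modulusE; case: l => x y /=; rewrite sqrrN. Qed.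

Lemma Re_wfac_ge l z : modulus l = 1 -> 1 - modulus z <= complex.Re (wfac l z).
Proof.
move=> l1; rewrite /wfac Re_addc Re_oppc /= lerD2l lerN2.
rewrite (le_trans (ler_norm _))// (le_trans (normr_Re_le _))//.
by rewrite modulusM modulusJ l1 mul1r.
Qed.

(** Moving a point of the right half-plane to the right increases its modulus. This makes every
    [zfac] at most 1 in modulus and lets [a + w] inherit the lower bounds of [w]. *)
Lemma Re_le_modulusD z b : 0 <= b -> 0 <= complex.Re z ->
  modulus z <= modulus (b%:C + z).
Proof.
case: z => x y /= b0 x0.
rewrite !modulusE/= add0r ler_wsqrtr// lerD2r ler_pXn2r ?nnegrE ?addr_ge0//.
by rewrite lerDr.
Qed.

Lemma modulus_wfacD_ge l z b : modulus l = 1 -> modulus z < 1 -> 0 <= b ->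
  1 - modulus z <= modulus (b%:C + wfac l z).
Proof.
move=> l1 z1 b0; apply: le_trans (Re_wfac_ge z l1) _.
apply: le_trans (ler_norm _) _; apply: le_trans (normr_Re_le _) _.
apply: Re_le_modulusD => //; apply: le_trans (Re_wfac_ge z l1).
by rewrite subr_ge0 ltW.
Qed.

Lemma wfac_neq0 l z : modulus l = 1 -> modulus z < 1 -> wfac l z != 0.
Proof.
move=> l1 z1; rewrite -modulus_eq0 gt_eqF//.
have := modulus_wfacD_ge l1 z1 (lexx 0); rewrite add0r; lra.
Qed.

Lemma wfacD_neq0 l z b : modulus l = 1 -> modulus z < 1 -> 0 <= b ->
  b%:C + wfac l z != 0.
Proof.
move=> l1 z1 b0; rewrite -modulus_eq0 gt_eqF//.
have := modulus_wfacD_ge l1 z1 b0; lra.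
Qed.

Lemma approx2_wfacV l z b : modulus l = 1 -> modulus z < 1 -> 0 <= b ->
  approx2 (2 / (1 - modulus z) ^+ 3) ((1 - modulus z) / 2)
    (fun x => (b%:C + wfac l x)^-1) z (l^* / (b%:C + wfac l z) ^+ 2).
Proof.
move=> l1 z1 b0; apply: approx2_inv; rewrite ?subr_gt0 ?modulusJ//.
exact: modulus_wfacD_ge.
Qed.

Lemma modulus_disc_shift z h : modulus z < 1 ->
  modulus h < (1 - modulus z) / 2 -> modulus (z + h) < 1.
Proof. by move=> z1 h1; have := modulusD z h; lra. Qed.

End DiscFactors.

(** * The Herglotz sum and the product of the factors, as limits with derivatives *)

Section GandP.
Context {R : realType} (a : nat -> R) (l : nat -> R[i]).
Context (a0 : forall n, 0 < a n) (l1 : forall n, modulus (l n) = 1)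
  (ca : cvgn (series a)).
Implicit Types (z h : R[i]).

Local Notation w n z := (wfac (l n) z).

Definition herglotz_part N z := \sum_(n < N) ((a n)%:C * (2 * (w n z)^-1 - 1)).
Definition herglotz z := limC (herglotz_part ^~ z).
Definition dherglotz_part N z := \sum_(n < N) ((a n)%:C * (2 * ((l n)^* / (w n z) ^+ 2))).
Definition dherglotz z := limC (dherglotz_part ^~ z).

(** This is [w / (a + w)], written as an affine function of the inverse of [a + w] so that
    [approx2_affine] applies and the distance to 1 is visible. *)
Definition zfac n z := 1 - (a n)%:C * ((a n)%:C + w n z)^-1.
Definition zprod_part N z := \prod_(n < N) zfac n z.
Definition zprod z := limC (zprod_part ^~ z).
(** Logarithmic derivative of the partial product: with [w' = - conj(l)], each factor contributes
    [w' / w - w' / (a + w) = a w' / (w (a + w))]. *)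
Definition dlogzprod_part N z :=
  \sum_(n < N) (- ((a n)%:C * ((l n)^* / (w n z * ((a n)%:C + w n z))))).
Definition dlogzprod z := limC (dlogzprod_part ^~ z).

Lemma series_ge0_le (x : nat -> R) : (forall n, 0 <= x n) -> cvgn (series x) ->
  forall N, \sum_(n < N) x n <= limn (series x).
Proof.
move=> x0 cx N; have := nondecreasing_cvgn_le _ cx N.
rewrite /series/= big_mkord; apply.
by apply: nondecreasing_series => n _ _.
Qed.

Lemma cvgC_series (c : nat -> R[i]) (K : R) : (forall n, modulus (c n) <= K * a n) ->
  cvgC (fun N => \sum_(n < N) c n) (limC (fun N => \sum_(n < N) c n)).
Proof.
move=> cK; apply: (@cvgC_increments _ _ (fun n => K * a n)).
  by move=> n; rewrite big_ord_recr/= addrC addrK.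
exact: is_cvg_seriesZ.
Qed.

Lemma modulus_a n : modulus (a n)%:C = a n.
Proof. by rewrite modulus_real gtr0_norm. Qed.

Lemma modulus2 : modulus (2 : R[i]) = 2.
Proof. by have := @modulus_real R 2; rewrite rmorph_nat ger0_norm. Qed.

Lemma inv_wfac_le n z : modulus z < 1 -> (modulus (w n z))^-1 <= (1 - modulus z)^-1.
Proof.
move=> z1; have d0 : 0 < 1 - modulus z by rewrite subr_gt0.
have := modulus_wfacD_ge (l1 n) z1 (lexx 0); rewrite add0r => H.
by rewrite lef_pV2 ?posrE// (lt_le_trans d0).
Qed.

Lemma inv_wfacD_le n z : modulus z < 1 ->
  (modulus ((a n)%:C + w n z))^-1 <= (1 - modulus z)^-1.
Proof.
move=> z1; have d0 : 0 < 1 - modulus z by rewrite subr_gt0.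
have H := modulus_wfacD_ge (l1 n) z1 (ltW (a0 n)).
by rewrite lef_pV2 ?posrE// (lt_le_trans d0).
Qed.

Lemma cvgC_herglotz_part z : modulus z < 1 -> cvgC (herglotz_part ^~ z) (herglotz z).
Proof.
move=> z1; apply: (@cvgC_series
  (fun n => (a n)%:C * (2 * (w n z)^-1 - 1)) (2 / (1 - modulus z) + 1)) => n.
rewrite modulusM modulus_a mulrC ler_wpM2r ?(ltW (a0 n))//.
rewrite (le_trans (modulusD _ _))// modulusN modulus1 lerD2r modulusM modulus2.
by rewrite modulusV ler_wpM2l// inv_wfac_le.
Qed.

Lemma cvgC_dherglotz_part z : modulus z < 1 -> cvgC (dherglotz_part ^~ z) (dherglotz z).
Proof.
move=> z1; apply: (@cvgC_series
  (fun n => (a n)%:C * (2 * ((l n)^* / (w n z) ^+ 2))) (2 / (1 - modulus z) ^+ 2)) => n.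
rewrite modulusM modulus_a mulrC ler_wpM2r ?(ltW (a0 n))//.
rewrite !modulusM modulus2 modulusV modulusJ l1 mul1r ler_wpM2l//.
rewrite !expr2 modulusM !invfM; apply: ler_pM; rewrite ?invr_ge0 ?modulus_ge0//;
  exact: inv_wfac_le.
Qed.

Lemma quad_derive_herglotz z : modulus z < 1 -> quad_derive herglotz z (dherglotz z).
Proof.
move=> z1; have d0 : 0 < 1 - modulus z by rewrite subr_gt0.
set d := 1 - modulus z in d0 *.
exists (limn (series a) * (2 * (2 / d ^+ 3))), (d / 2).
have A0 : 0 <= limn (series a).
  by have := series_ge0_le (fun n => ltW (a0 n)) ca 0%N; rewrite big_ord0.
have K0 : 0 <= 2 * (2 / d ^+ 3) by rewrite mulr_ge0// divr_ge0// exprn_ge0// ltW.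
split; [by rewrite mulr_ge0|by rewrite divr_gt0|].
apply: (@approx2_limit _ _ _ herglotz_part (dherglotz_part ^~ z)).
- by rewrite divr_gt0.
- by move=> h hr; apply: cvgC_herglotz_part; exact: modulus_disc_shift hr.
- exact: cvgC_dherglotz_part.
move=> N h hr.
(* All terms share the radius [d / 2], and their constants are proportional to [a n], so the partial
   sums obey one bound for every [N]. *)
have H n : approx2 (a n * (2 * (2 / d ^+ 3))) (d / 2)
    (fun x => (a n)%:C * (2 * (w n x)^-1 - 1)) z
    ((a n)%:C * (2 * ((l n)^* / (w n z) ^+ 2))).
  have H0 : approx2 (2 / d ^+ 3) (d / 2) (fun x => (w n x)^-1) z
      ((l n)^* / (w n z) ^+ 2).
    have := approx2_wfacV (l1 n) z1 (lexx 0).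
    by rewrite add0r; under eq_fun do rewrite add0r.
  have := approx2_affine (a n)%:C 0 (approx2_affine 2 (-1) H0).
  by rewrite modulus_a modulus2; under eq_fun do rewrite addr0.
apply: (le_trans (@approx2_sum _ _ N _ _ _ _ H h hr)).
rewrite ler_wpM2r ?sqr_ge0// -mulr_suml ler_wpM2r//.
exact: (series_ge0_le (fun n => ltW (a0 n)) ca).
Qed.

Lemma zfacE n z : modulus z < 1 -> zfac n z = w n z / ((a n)%:C + w n z).
Proof.
move=> z1; have D0 := wfacD_neq0 (l1 n) z1 (ltW (a0 n)).
by rewrite /zfac; field.
Qed.

Lemma modulus_zfac_le1 n z : modulus z < 1 -> modulus (zfac n z) <= 1.
Proof.
move=> z1; rewrite zfacE// modulusM modulusV.
have D0 : 0 < modulus ((a n)%:C + w n z).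
  by rewrite lt_neqAle modulus_ge0 eq_sym modulus_eq0 wfacD_neq0// ltW.
rewrite ler_pdivrMr// mul1r; apply: Re_le_modulusD; first exact: ltW.
by apply: le_trans (Re_wfac_ge z (l1 n)); rewrite subr_ge0 ltW.
Qed.

Lemma modulus_zprod_part_le1 N z : modulus z < 1 -> modulus (zprod_part N z) <= 1.
Proof.
move=> z1; rewrite /zprod_part (@modulus_prod _ N (zfac ^~ z)).
by apply: prodr_ile1 => i _; rewrite modulus_ge0 modulus_zfac_le1.
Qed.

Lemma modulus_zprod_part_le n N z : modulus z < 1 -> (n < N)%N ->
  modulus (zprod_part N z) <= modulus (zfac n z).
Proof.
move=> z1 nN; rewrite /zprod_part (@modulus_prod _ N (zfac ^~ z)).
rewrite (bigD1 (Ordinal nN))//= ler_piMr ?modulus_ge0//.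
by apply: prodr_ile1 => i _; rewrite modulus_ge0 modulus_zfac_le1.
Qed.

(** The increment of the partial products is [- P_n a_n / (a_n + w_n)] with [|P_n| <= 1], hence at
    most [a_n / (1 - |z|)]. *)
Lemma cvgC_zprod_part z : modulus z < 1 -> cvgC (zprod_part ^~ z) (zprod z).
Proof.
move=> z1; apply: (@cvgC_increments _ _ (fun n => (1 - modulus z)^-1 * a n)).
  move=> n; rewrite /zprod_part big_ord_recr/= -/(zprod_part n z).
  have -> : zprod_part n z * zfac n z - zprod_part n z =
      - (zprod_part n z * (a n)%:C * ((a n)%:C + w n z)^-1) by rewrite /zfac; ring.
  rewrite modulusN !modulusM modulusV modulus_a mulrC; apply: ler_pM.
  - by rewrite invr_ge0 modulus_ge0.
  - by rewrite mulr_ge0 ?modulus_ge0// ltW.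
  - exact: inv_wfacD_le.
  - by rewrite ler_piMl ?modulus_zprod_part_le1// ltW.
exact: is_cvg_seriesZ.
Qed.

Lemma cvgC_dlogzprod_part z : modulus z < 1 -> cvgC (dlogzprod_part ^~ z) (dlogzprod z).
Proof.
move=> z1; apply: (@cvgC_series
    (fun n => - ((a n)%:C * ((l n)^* / (w n z * ((a n)%:C + w n z)))))
    (1 / (1 - modulus z) ^+ 2)) => n.
rewrite modulusN modulusM modulus_a mulrC ler_wpM2r ?(ltW (a0 n))//.
rewrite !modulusM modulusV modulusJ l1 !mul1r.
rewrite !expr2 modulusM !invfM; apply: ler_pM; rewrite ?invr_ge0 ?modulus_ge0//.
  exact: inv_wfac_le.
exact: inv_wfacD_le.
Qed.

Definition dzprod z := zprod z * dlogzprod z.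

Lemma quad_derive_zprod z : modulus z < 1 -> quad_derive zprod z (dzprod z).
Proof.
move=> z1; have d0 : 0 < 1 - modulus z by rewrite subr_gt0.
set d := 1 - modulus z in d0 *.
have d1 : d <= 1 by rewrite /d gerBl modulus_ge0.
set B := limn (series a) * (2 / d ^+ 3).
have A0 : 0 <= limn (series a).
  by have := series_ge0_le (fun n => ltW (a0 n)) ca 0%N; rewrite big_ord0.
have K0 : 0 <= 2 / d ^+ 3 by rewrite divr_ge0// exprn_ge0// ltW.
have B0 : 0 <= B by rewrite mulr_ge0.
exists (B * (1 + 2 * B)), (d / 2).
have r0 : 0 < d / 2 by rewrite divr_gt0.
split; [by rewrite mulr_ge0// addr_ge0// mulr_ge0|exact: r0|].
apply: (@approx2_limit _ _ _ zprod_part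
  (fun n => zprod_part n z * dlogzprod_part n z)) => //.
- by move=> h hr; apply: cvgC_zprod_part; exact: modulus_disc_shift hr.
- by apply: cvgCM; [exact: cvgC_zprod_part|exact: cvgC_dlogzprod_part].
move=> N.
(* [a n (2 / d^3)] serves as bound both for the remainder of a factor and for its derivative; the
   latter is at most [a n / d^2], and [d <= 1]. *)
apply: (@approx2_prod _ _ N B (fun n => a n * (2 / d ^+ 3)) zfac z
  (fun n => - (a n)%:C * ((l n)^* / ((a n)%:C + w n z) ^+ 2)) _ _ _ _ _
  (fun n => zprod_part n z * dlogzprod_part n z)).
- by rewrite r0; lra.
- move=> n h hr; apply: modulus_zfac_le1; exact: modulus_disc_shift hr.
- move=> n; rewrite modulusM modulusN modulus_a ler_wpM2l ?(ltW (a0 n))//.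
  rewrite modulusM modulusV modulusJ l1 expr2 modulusM -expr2.
  apply: (@le_trans _ _ (1 / d ^+ 2)).
    rewrite ler_pM2l// !expr2 !invfM.
    by apply: ler_pM; rewrite ?invr_ge0 ?modulus_ge0 ?inv_wfacD_le.
  rewrite ler_pM ?invr_ge0 ?exprn_ge0 ?(ltW d0)// ?ler1n//.
  rewrite lef_pV2 ?posrE ?exprn_gt0//.
  by rewrite [leLHS]exprS ler_piMl// exprn_ge0// ltW.
- move=> n.
  have H := approx2_affine (- (a n)%:C) 1 (approx2_wfacV (l1 n) z1 (ltW (a0 n))).
  rewrite modulusN modulus_a in H.
  rewrite (_ : zfac n = fun x => - (a n)%:C * ((a n)%:C + w n x)^-1 + 1)//.
  by apply/funext => x; rewrite /zfac; ring.
- move=> m; rewrite -mulr_suml ler_wpM2r//.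
  exact: (series_ge0_le (fun n => ltW (a0 n)) ca).
- by rewrite /dlogzprod_part big_ord0 mulr0.
(* The Leibniz recursion holds because the added term of the logarithmic derivative is that of
   [zfac m]; both denominators are nonzero on the disc. *)
- move=> m; rewrite /dlogzprod_part /zprod_part !big_ord_recr/=.
  rewrite -/(zprod_part m z) zfacE//.
  have D0 := wfacD_neq0 (l1 m) z1 (ltW (a0 m)); have w0 := wfac_neq0 (l1 m) z1.
  by field; apply/andP.
Qed.

End GandP.

(** * Pointwise bound of the derivative by the sum of pole kernels *)

Section DerivativeBound.
Context {R : realType} (a : nat -> R) (l : nat -> R[i]).
Context (a0 : forall n, 0 < a n) (l1 : forall n, modulus (l n) = 1)
  (ca : cvgn (series a)).
Implicit Types (z h : R[i]).

Local Notation w n z := (wfac (l n) z).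
Local Notation u n z := (complex.Re (wfac (l n) z)).
Local Notation G := (herglotz a l).
Local Notation P := (zprod a l).

(** Cauchy-Schwarz without square roots. With [X, Y, T] the sums so far and [p, q, r] the new terms,
    the induction step reduces to [2 T r <= X q + p Y], and [(2 T r)^2 <= 4 (X q) (p Y) <= (X q + p
    Y)^2]. *)
Lemma sum_sqr_le n (x y t : nat -> R) : (forall i, 0 <= x i) -> (forall i, 0 <= y i) ->
  (forall i, 0 <= t i) -> (forall i, t i ^+ 2 <= x i * y i) ->
  (\sum_(i < n) t i) ^+ 2 <= (\sum_(i < n) x i) * (\sum_(i < n) y i).
Proof.
move=> x0 y0 t0 H; elim: n => [|n IH]; first by rewrite !big_ord0 mulr0 expr0n.
rewrite !big_ord_recr/=.
have X0 : 0 <= \sum_(i < n) x i by apply: sumr_ge0.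
have Y0 : 0 <= \sum_(i < n) y i by apply: sumr_ge0.
have T0 : 0 <= \sum_(i < n) t i by apply: sumr_ge0.
move: (x0 n) (y0 n) (t0 n) (H n) IH X0 Y0 T0.
move: (x n) (y n) (t n) (\sum_(i < n) x i) (\sum_(i < n) y i) (\sum_(i < n) t i).
move=> p q r X Y T p0 q0 r0 rpq TXY X0 Y0 T0.
suff : 2 * (T * r) <= X * q + p * Y by nra.
rewrite -(@ler_pXn2r _ 2) ?nnegrE ?addr_ge0 ?mulr_ge0//.
have h1 : T ^+ 2 * r ^+ 2 <= (X * Y) * (p * q) by apply: ler_pM; rewrite ?sqr_ge0.
have h2 : 0 <= (X * q - p * Y) ^+ 2 by exact: sqr_ge0.
have -> : (2 * (T * r)) ^+ 2 = 4 * (T ^+ 2 * r ^+ 2) by ring.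
nra.
Qed.

Definition sumT z := limn (series (fun n => a n / modulus (w n z) ^+ 2)).
Definition sumU z := limn (series (fun n => a n * u n z / modulus (w n z) ^+ 2)).
Definition sumW z := limn (series (fun n => a n * pole_kernel (a n) (l n) z)).

Definition inner_zprod z := expC (- G z) * P z.
Definition dinner_zprod z :=
  expC (- G z) * (- dherglotz a l z) * P z + expC (- G z) * dzprod a l z.

Section AtPoint.
Context (z : R[i]) (z1 : modulus z < 1).
Let d := 1 - modulus z.

Lemma gap_gt0 : 0 < d. Proof. by rewrite subr_gt0. Qed.

Lemma Re_wfac_ge_gap n : d <= u n z. Proof. exact: Re_wfac_ge. Qed.
Lemma Re_wfac_gt0 n : 0 < u n z.
Proof. exact: lt_le_trans gap_gt0 (Re_wfac_ge_gap n). Qed.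
Lemma modulus_wfac_gt0 n : 0 < modulus (w n z).
Proof. by rewrite lt_neqAle modulus_ge0 eq_sym modulus_eq0 wfac_neq0. Qed.
Lemma modulus_wfacD_gt0 n : 0 < modulus ((a n)%:C + w n z).
Proof.
by rewrite lt_neqAle modulus_ge0 eq_sym modulus_eq0 wfacD_neq0// ltW.
Qed.

Lemma cvgn_ge0_le (x : nat -> R) K : (forall n, 0 <= x n) ->
  (forall n, x n <= K * a n) -> cvgn (series x).
Proof.
move=> x0 xK; apply: (@series_le_cvg _ x (fun n => K * a n)) => //.
  by move=> n; exact: le_trans (xK n).
exact: is_cvg_seriesZ.
Qed.

Lemma termT_ge0 n : 0 <= a n / modulus (w n z) ^+ 2.
Proof. by rewrite divr_ge0 ?sqr_ge0// ltW. Qed.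

Lemma termU_ge0 n : 0 <= a n * u n z / modulus (w n z) ^+ 2.
Proof. by rewrite divr_ge0 ?sqr_ge0// mulr_ge0// ltW// Re_wfac_gt0. Qed.

Lemma pole_kernel_ge0 n : 0 <= pole_kernel (a n) (l n) z.
Proof. by rewrite invr_ge0 mulr_ge0 ?sqr_ge0// ltW// Re_wfac_gt0. Qed.

Lemma termW_ge0 n : 0 <= a n * pole_kernel (a n) (l n) z.
Proof. by rewrite mulr_ge0 ?pole_kernel_ge0// ltW. Qed.

Lemma cvgn_T : cvgn (series (fun n => a n / modulus (w n z) ^+ 2)).
Proof.
apply: (@cvgn_ge0_le _ (d ^- 2)) => n; first exact: termT_ge0.
rewrite mulrC ler_wpM2r ?(ltW (a0 n))// -!exprVn.
by rewrite ler_pXn2r ?nnegrE ?invr_ge0 ?modulus_ge0 ?(ltW gap_gt0)// inv_wfac_le.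
Qed.

Lemma cvgn_U : cvgn (series (fun n => a n * u n z / modulus (w n z) ^+ 2)).
Proof.
apply: (@cvgn_ge0_le _ d^-1) => n; first exact: termU_ge0.
rewrite -mulrA mulrC ler_wpM2r ?(ltW (a0 n))//.
apply: le_trans (inv_wfac_le l1 n z1); rewrite expr2 invfM mulrA.
rewrite ler_piMl ?invr_ge0 ?modulus_ge0// ler_pdivrMr ?modulus_wfac_gt0// mul1r.
exact: le_trans (ler_norm _) (normr_Re_le _).
Qed.

Lemma cvgn_W : cvgn (series (fun n => a n * pole_kernel (a n) (l n) z)).
Proof.
apply: (@cvgn_ge0_le _ (d * d ^+ 2)^-1) => n; first exact: termW_ge0.
rewrite mulrC ler_wpM2r ?(ltW (a0 n))// /pole_kernel.
rewrite lef_pV2 ?posrE ?mulr_gt0 ?exprn_gt0 ?gap_gt0 ?Re_wfac_gt0 ?modulus_wfacD_gt0//.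
apply: ler_pM; rewrite ?exprn_ge0 ?(ltW gap_gt0) ?Re_wfac_ge_gap//.
rewrite ler_pXn2r ?nnegrE ?modulus_ge0 ?(ltW gap_gt0)//.
by apply: modulus_wfacD_ge => //; exact: ltW.
Qed.

Lemma sumT_ge0 : 0 <= sumT z.
Proof. by have := series_ge0_le termT_ge0 cvgn_T 0%N; rewrite big_ord0. Qed.
Lemma sumU_ge0 : 0 <= sumU z.
Proof. by have := series_ge0_le termU_ge0 cvgn_U 0%N; rewrite big_ord0. Qed.
Lemma sumW_ge0 : 0 <= sumW z.
Proof. by have := series_ge0_le termW_ge0 cvgn_W 0%N; rewrite big_ord0. Qed.

Lemma modulus_dherglotz_le : modulus (dherglotz a l z) <= 2 * sumT z.
Proof.
apply: (cvgC_modulus_le (cvgC_dherglotz_part a0 l1 ca z1)) => N.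
apply: (le_trans (modulus_sum N (fun n => (a n)%:C * (2 * ((l n)^* / w n z ^+ 2))))).
apply: (@le_trans _ _ (\sum_(n < N) 2 * (a n / modulus (w n z) ^+ 2))).
  apply: ler_sum => n _; rewrite modulusM (modulus_a a0) modulusM modulus2.
  rewrite modulusM modulusV expr2 modulusM modulusJ l1 -expr2 mul1r.
  by rewrite mulrCA.
by rewrite -mulr_sumr ler_wpM2l// (series_ge0_le termT_ge0 cvgn_T).
Qed.

Lemma modulus_dlogzprod_le : modulus (dlogzprod a l z) <= sumT z.
Proof.
apply: (cvgC_modulus_le (cvgC_dlogzprod_part a0 l1 ca z1)) => N.
apply: (le_trans (modulus_sum N (fun n =>
  - ((a n)%:C * ((l n)^* / (w n z * ((a n)%:C + w n z))))))).
apply: le_trans (series_ge0_le termT_ge0 cvgn_T N).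
apply: ler_sum => n _; rewrite modulusN modulusM (modulus_a a0).
rewrite ler_wpM2l ?(ltW (a0 n))// modulusM modulusV !modulusM modulusJ l1 mul1r.
rewrite lef_pV2 ?posrE ?exprn_gt0 ?mulr_gt0 ?modulus_wfac_gt0 ?modulus_wfacD_gt0// expr2.
by rewrite ler_wpM2l ?modulus_ge0// Re_le_modulusD// ltW// Re_wfac_gt0.
Qed.

(** Termwise, [Re (2 / w - 1) = 2 Re w / |w|^2 - 1]. *)
Lemma Re_herglotz : complex.Re (G z) = 2 * sumU z - limn (series a).
Proof.
have [+ _] := cvgC_herglotz_part a0 l1 ca z1.
have -> : (fun N => complex.Re (herglotz_part a l N z)) =
    (fun N => 2 * series (fun n => a n * u n z / modulus (w n z) ^+ 2) N - series a N).
  apply/funext => N; rewrite /series/= !big_mkord mulr_sumr -sumrB /herglotz_part.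
  rewrite (big_morph (@complex.Re R) (@Re_addc R) (erefl : complex.Re 0 = 0)).
  apply: eq_bigr => n _; rewrite sqr_modulus.
  have := exprn_gt0 2 (modulus_wfac_gt0 n); rewrite sqr_modulus.
  case: (w n z) => x y /= h.
  by field; rewrite gt_eqF.
move=> /(cvg_lim (@Rhausdorff R)) <-; apply/cvg_lim => //.
by apply: cvgB; [apply: cvgMr; exact: cvgn_U|exact: ca].
Qed.

Lemma modulus_expG_le1 : modulus (expC (- G z)) <= expR (limn (series a)).
Proof.
rewrite modulus_expC Re_oppc Re_herglotz ler_expR.
have := sumU_ge0; lra.
Qed.

Lemma modulus_zprod_le1 : modulus (P z) <= 1.
Proof.
apply: (cvgC_modulus_le (cvgC_zprod_part a0 l1 ca z1)) => N.
exact: modulus_zprod_part_le1.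
Qed.

(** The other factors have modulus at most 1, so every partial product containing [zfac n] is below
    it. One product thus supplies to each term of a sum the zero that this term needs. *)
Lemma modulus_zprod_le n : modulus (P z) <= modulus (zfac a l n z).
Proof.
have := cvgC_modulus (cvgC_zprod_part a0 l1 ca z1) => H.
rewrite -(cvg_lim (@Rhausdorff R) H); apply: limr_le; first exact: cvgP H.
exists n.+1 => // N /= nN; exact: modulus_zprod_part_le.
Qed.

(** The sum [V] is bypassed: [|P| <= |w_n| / |a_n + w_n|] is inserted termwise before
    Cauchy-Schwarz, and [(|w_n| / |a_n + w_n|)^2 (a_n / |w_n|^2)^2] is exactly the product of the
    [n]-th terms of [U] and [W]. *)
Lemma sqr_zprod_sumT_le : (modulus (P z) * sumT z) ^+ 2 <= sumU z * sumW z.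
Proof.
have H N : (modulus (P z) * \sum_(n < N) a n / modulus (w n z) ^+ 2) ^+ 2 <=
    sumU z * sumW z.
  rewrite mulr_sumr.
  pose x n := a n * u n z / modulus (w n z) ^+ 2.
  pose y n := a n * pole_kernel (a n) (l n) z.
  apply: (le_trans (@sum_sqr_le N x y
    (fun n => modulus (P z) * (a n / modulus (w n z) ^+ 2)) termU_ge0 termW_ge0 _ _)).
  - by move=> n; rewrite mulr_ge0 ?modulus_ge0// termT_ge0.
  - move=> n; have Pg := modulus_zprod_le n.
    have g0 := modulus_ge0 (P z).
    rewrite exprMn.
    apply: (@le_trans _ _ (modulus (zfac a l n z) ^+ 2 *
        (a n / modulus (w n z) ^+ 2) ^+ 2)).
      by rewrite ler_wpM2r ?sqr_ge0// ler_pXn2r ?nnegrE ?modulus_ge0.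
    rewrite zfacE// modulusM modulusV /x /y /pole_kernel.
    have := Re_wfac_gt0 n; have := modulus_wfac_gt0 n; have := modulus_wfacD_gt0 n.
    move: (modulus (w n z)) (modulus (_ + _)) (u n z) => p q r q0 p0 r0.
    rewrite le_eqVlt; apply/orP; left; apply/eqP; field.
    by rewrite !gt_eqF.
  - apply: ler_pM; rewrite ?sumr_ge0//; first by move=> n _; exact: termU_ge0.
    + by move=> n _; exact: termW_ge0.
    + exact: (series_ge0_le termU_ge0 cvgn_U).
    + exact: (series_ge0_le termW_ge0 cvgn_W).
have c : (modulus (P z) * series (fun n => a n / modulus (w n z) ^+ 2) N) ^+ 2
    @[N --> \oo] --> (modulus (P z) * sumT z) ^+ 2.
  rewrite expr2; under eq_fun do rewrite expr2.
  by apply: cvgM; apply: cvgMr; exact: cvgn_T.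
rewrite -(cvg_lim (@Rhausdorff R) c); apply: limr_le; first exact: cvgP c.
by apply: nearW => N; rewrite /series/= big_mkord.
Qed.

Lemma quad_derive_inner_zprod : quad_derive inner_zprod z (dinner_zprod z).
Proof.
apply: quad_deriveM; last exact: quad_derive_zprod.
apply: (@quad_derive_expC _ (fun x => - G x)).
have [C [r [C0 r0 H]]] := quad_derive_herglotz a0 l1 ca z1.
exists C, r; split => // h hr.
by rewrite -modulusN mulrN !opprD !opprK; exact: H.
Qed.

Lemma sqr_modulus_dinner_zprod_le : modulus (dinner_zprod z) ^+ 2 <=
  9 * expR (2 * limn (series a)) * sumW z.
Proof.
set E := modulus (expC (- G z)); set p := modulus (P z); set T := sumT z.
have E0 : 0 <= E by exact: modulus_ge0.
have p0 : 0 <= p by exact: modulus_ge0.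
have H : modulus (dinner_zprod z) <= 3 * (E * (p * T)).
  apply: (le_trans (modulusD _ _)); rewrite !modulusM modulusN -/E -/p.
  have h1 : E * modulus (dherglotz a l z) * p <= E * (2 * T) * p.
    by rewrite ler_wpM2r// ler_wpM2l// modulus_dherglotz_le.
  have h2 : E * (p * modulus (dlogzprod a l z)) <= E * (p * T).
    by rewrite ler_wpM2l// ler_wpM2l// modulus_dlogzprod_le.
  lra.
apply: (@le_trans _ _ ((3 * (E * (p * T))) ^+ 2)).
  by rewrite ler_pXn2r ?nnegrE ?modulus_ge0// !mulr_ge0// sumT_ge0.
have -> : (3 * (E * (p * T))) ^+ 2 = 9 * (E ^+ 2 * (p * T) ^+ 2) by ring.
rewrite -mulrA ler_wpM2l//.
apply: (@le_trans _ _ (E ^+ 2 * (sumU z * sumW z))).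
  by rewrite ler_wpM2l ?sqr_ge0// sqr_zprod_sumT_le.
rewrite mulrA ler_wpM2r ?sumW_ge0//.
(* The absorption of [U]: [U exp (- 4 U) <= 1], since [exp (4 U) >= 1 + 4 U >= U]. *)
have -> : E ^+ 2 = expR (2 * limn (series a)) * expR (- (4 * sumU z)).
  rewrite /E modulus_expC Re_oppc Re_herglotz expr2 -!expRD; congr expR; ring.
rewrite -mulrA ler_piMr ?expR_ge0// expRN mulrC ler_pdivrMr ?expR_gt0// mul1r.
by have := expR_ge1Dx (4 * sumU z); have := sumU_ge0; lra.
Qed.

End AtPoint.

(** At 0 every [w_n] is 1, so the factors are [1 / (1 + a_n) >= exp (- a_n)] and the product is at
    least [exp (- sum a_n)]. *)
Lemma zprod0_neq0 : P 0 != 0.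
Proof.
have z1 : modulus (0 : R[i]) < 1 by rewrite modulus0.
rewrite -modulus_eq0 gt_eqF//.
apply: (@lt_le_trans _ _ (expR (- limn (series a)))); first exact: expR_gt0.
have H := cvgC_modulus (cvgC_zprod_part a0 l1 ca z1).
rewrite -(cvg_lim (@Rhausdorff R) H); apply: limr_ge; first exact: cvgP H.
apply: nearW => N.
apply: (@le_trans _ _ (expR (- \sum_(n < N) a n))).
  by rewrite ler_expR lerN2 (series_ge0_le (fun n => ltW (a0 n)) ca).
rewrite -sumrN expR_sum /zprod_part (@modulus_prod _ N (zfac a l ^~ 0)).
apply: ler_prod => n _; rewrite expR_ge0/= zfacE// /wfac mulr0 subr0.
rewrite modulusM modulus1 mul1r modulusV.
have -> : (a n)%:C + 1 = (a n + 1)%:C :> R[i] by rewrite rmorphD rmorph1.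
rewrite modulus_real gtr0_norm ?addr_gt0// expRN.
rewrite lef_pV2 ?posrE ?expR_gt0 ?addr_gt0// addrC.
exact: expR_ge1Dx.
Qed.

End DerivativeBound.

(** * Area integral of the kernel *)

Section StripIntegral.
Context {R : realType}.
Local Notation mu := (@lebesgue_measure R).

(** On nonnegative reals the inverse is the power of exponent -1, including at 0 where both are 0,
    and real powers are measurable. *)
Lemma measurable_funV d (T : measurableType d) (D : set T) (f : T -> R) :
  measurable_fun D f -> (forall x, D x -> 0 <= f x) ->
  measurable_fun D (fun x => (f x)^-1).
Proof.
move=> mf f0.
apply: (eq_measurable_fun (fun x => f x `^ (-1))).
  by move=> x /[!inE] Dx; rewrite powR_inv1// f0.
exact: (measurableT_comp (measurable_powR (-1)) mf).
Qed.

(** A primitive is [atan ((x - x0) / b) / b], and [atan] varies by less than [pi], whatever the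
    centre [x0]. *)
Lemma integral_cauchy_kernel_le (b x0 : R) : 0 < b ->
  (\int[mu]_(x in `[(-1)%R, 1%R]) ((b ^+ 2 + (x - x0) ^+ 2)^-1)%:E <= (pi / b)%:E)%E.
Proof.
move=> b0.
have der (x : R) : is_derive x (1 : R) (fun x : R => atan ((x - x0) / b) / b)
    (b ^+ 2 + (x - x0) ^+ 2)^-1.
  have h : is_derive x (1 : R) (fun y : R => (y - x0) / b) b^-1.
    apply: is_derive_eq; rewrite /GRing.scale/= ?mulr0 ?addr0 ?add0r ?subr0.
    by ring.
  have h2 := @is_derive1_comp R atan (fun y => (y - x0) / b) x _ _ (is_derive1_atan _) h.
  apply: is_derive_eq; rewrite /GRing.scale/= ?mulr0 ?addr0 ?add0r.
  field.
  by rewrite !gt_eqF// ltr_pwDl ?exprn_gt0// sqr_ge0.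
have cF (x : R) : {for x, continuous (fun x : R => atan ((x - x0) / b) / b)}.
  by apply: differentiable_continuous; apply/derivable1_diffP; exact: ex_derive.
rewrite (@continuous_FTC2 _ _ (fun x => atan ((x - x0) / b) / b)).
- rewrite -EFinB lee_fin -mulrBl ler_pM2r ?invr_gt0//.
  have := atan_ltpi2 ((1 - x0) / b); have := atan_gtNpi2 ((-1 - x0) / b); lra.
- by lra.
- apply: continuous_subspaceT => x.
  apply: cvgV; first by rewrite gt_eqF// ltr_pwDl ?exprn_gt0// sqr_ge0.
  under eq_fun do rewrite [X in _ + X]expr2; rewrite [X in _ + X]expr2.
  apply: cvgD; first exact: cvg_cst.
  by apply: cvgM; apply: cvgB;
    [exact: cvg_id|exact: cvg_cst|exact: cvg_id|exact: cvg_cst].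
- split.
  + by move=> x _; exact: ex_derive.
  + by apply: cvg_at_right_filter; exact: cF.
  + by apply: cvg_at_left_filter; exact: cF.
- by move=> x _; rewrite derive1E; exact: derive_val.
Qed.

Lemma measurable_affine_itv (E c al : R) :
  measurable [set y : R | al < E - c * y <= 2 * al].
Proof.
have m : measurable_fun setT (fun y : R => al < E - c * y <= 2 * al).
  by repeat first [apply: measurable_and | apply: measurable_fun_ler |
    apply: measurable_fun_ltr | apply: measurable_funB | apply: measurable_funM |
    exact: measurable_cst | exact: measurable_id].
by have := m measurableT [set true]; rewrite setTI => H; exact: H.
Qed.

Lemma measure_affine_itv_le (E c al : R) : 2^-1 <= `|c| -> 0 < al ->
  (mu [set y : R | al < E - c * y <= 2 * al]%R <= (2 * al)%:E)%E.
Proof.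
move=> c2 al0.
have c0 : 0 < `|c| by lra.
have cn0 : c != 0 by rewrite -normr_gt0.
(* [m] is the point where [E - c y] takes its middle value [3/2 al], and [r] the half-length; the
   length [al / |c|] is at most [2 al]. *)
pose m := (E - 3 / 2 * al) / c; pose r := al / 2 / `|c|.
apply: (@le_trans _ _ (mu `[m - r, m + r]%classic)).
  apply: le_measure; rewrite ?inE//; first exact: measurable_affine_itv.
  move=> y /= /andP[y1 y2]; rewrite in_itv/= -ler_distl.
  have -> : y - m = - ((E - c * y) - 3 / 2 * al) / c by rewrite /m; field.
  rewrite normrM normrN normfV ler_pM2r ?invr_gt0// ler_norml.
  by apply/andP; split; lra.
rewrite lebesgue_measure_itv/= lte_fin.
have r0 : 0 < r by rewrite !divr_gt0.
rewrite (_ : m - r < m + r); last by lra.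
rewrite -EFinB lee_fin.
have -> : m + r - (m - r) = al * `|c|^-1 by rewrite /r; field; rewrite gt_eqF.
rewrite mulrC ler_wpM2r ?(ltW al0)//.
by rewrite -[leRHS]invrK lef_pV2 ?posrE// invr_gt0.
Qed.

Definition strip (d e c al : R) : set (R * R) :=
  [set p | (-1 <= p.1 <= 1) && (al < e - d * p.1 - c * p.2 <= 2 * al)].

(** The second factor depends on [p.1] alone, so that integration along [p.2] only measures a
    section of the strip. With [x0] a coordinate of the atom and [b = a + al], it dominates
    [1 / |a + w|^2] on the strip up to a factor 2. *)
Definition strip_kernel (d e c al x0 b : R) (p : R * R) : R :=
  \1_(strip d e c al) p * (b ^+ 2 + (p.1 - x0) ^+ 2)^-1.

Lemma measurable_strip d e c al : measurable (strip d e c al).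
Proof.
have m1 : measurable_fun setT (fun p : R * R => p.1) by exact: measurable_fst.
have m2 : measurable_fun setT (fun p : R * R => p.2) by exact: measurable_snd.
have m : measurable_fun setT (fun p : R * R =>
   (-1 <= p.1 <= 1) && (al < e - d * p.1 - c * p.2 <= 2 * al)).
  by repeat first [apply: measurable_and | apply: measurable_fun_ler |
    apply: measurable_fun_ltr | apply: measurable_funB | apply: measurable_funM |
    exact: measurable_cst | exact: m1 | exact: m2].
have := m measurableT [set true]; rewrite setTI => H; exact: H.
Qed.

Lemma strip_kernel_ge0 d e c al x0 b p : 0 <= strip_kernel d e c al x0 b p.
Proof. by rewrite mulr_ge0// invr_ge0 addr_ge0// sqr_ge0. Qed.

Lemma measurable_strip_kernel d e c al x0 b :
  measurable_fun setT (strip_kernel d e c al x0 b).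
Proof.
apply: measurable_funM; first by apply: measurable_indic; exact: measurable_strip.
apply: measurable_funV; last by move=> p _; rewrite addr_ge0// sqr_ge0.
apply: measurable_funD => //; apply: measurable_funX.
by apply: measurable_funB => //; exact: measurable_fst.
Qed.

Lemma iterated_integral_strip_kernel_le d e c al x0 b :
  2^-1 <= `|c| -> 0 < al -> 0 < b ->
  (\int[mu]_x \int[mu]_y (strip_kernel d e c al x0 b (x, y))%:E <=
   (2 * al * (pi / b))%:E)%E.
Proof.
move=> c2 al0 b0.
pose k (x : R) := (b ^+ 2 + (x - x0) ^+ 2)^-1.
have k0 x : 0 <= k x by rewrite invr_ge0 addr_ge0// sqr_ge0.
have mk : measurable_fun setT k.
  apply: measurable_funV; last by move=> p _; rewrite addr_ge0// sqr_ge0.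
  by apply: measurable_funD => //; apply: measurable_funX; exact: measurable_funB.
have inner x : (\int[mu]_y (strip_kernel d e c al x0 b (x, y))%:E <=
    (\1_`[(-1)%R, 1%R] x * k x * (2 * al))%:E)%E.
  have mS : measurable (xsection (strip d e c al) x).
    apply: measurable_xsection; exact: measurable_strip.
  have -> : (fun y => (strip_kernel d e c al x0 b (x, y))%:E) =
      (fun y => (k x)%:E * (\1_(xsection (strip d e c al) x) y)%:E)%E.
    apply/funext => y; rewrite /strip_kernel -EFinM mulrC /k/=; congr (_ * _)%:E.
    by rewrite !indicE; congr (nat_of_bool _)%:R; rewrite mem_xsection.
  rewrite ge0_integralZl ?lee_fin//=; last first.
    by apply/measurable_EFinP; exact: measurable_indic.
  rewrite integral_indic// setIT.
  have [x1|x1] := boolP (-1 <= x <= 1); last first.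
    have -> : xsection (strip d e c al) x = set0.
      apply/seteqP; split => // y; rewrite /xsection/= inE /strip/=.
      by rewrite (negbTE x1).
    rewrite measure0 mule0 lee_fin !mulr_ge0// ltW//.
  rewrite indicE mem_set; last by rewrite /= in_itv.
  rewrite mul1r EFinM lee_wpmul2l ?lee_fin//.
  apply: le_trans (measure_affine_itv_le (e - d * x) c2 al0).
  apply: le_measure; rewrite ?inE//; first exact: measurable_affine_itv.
  by move=> y; rewrite /xsection/= inE /strip/= => /andP[].
apply: (@le_trans _ _ (\int[mu]_x ((\1_`[(-1)%R, 1%R] x * k x * (2 * al))%:E))%E).
  apply: ge0_le_integral => //.
  - by move=> x _; apply: integral_ge0 => y _; rewrite lee_fin strip_kernel_ge0.
  - apply: (@measurable_fun_fubini_tonelli_F _ _ _ _ _ mu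
      (fun p => (strip_kernel d e c al x0 b p)%:E)).
    + by apply/measurable_EFinP; exact: measurable_strip_kernel.
    + by move=> p; rewrite lee_fin strip_kernel_ge0.
  - apply/measurable_EFinP; apply: measurable_funM => //.
    by apply: measurable_funM => //; exact: measurable_indic.
rewrite (_ : \int[mu]_x _ = \int[mu]_x ((2 * al)%:E *
    (((fun x => (k x)%:E) \_ `[(-1)%R, 1%R]) x)))%E; last first.
  apply: eq_integral => x _; rewrite patchE indicE.
  by case: ifPn => _; rewrite ?mul1r ?mul0r ?mule0// mulrC.
rewrite ge0_integralZl//=.
- rewrite -integral_mkcond [leRHS]EFinM lee_wpmul2l ?lee_fin ?mulr_ge0 ?(ltW al0)//.
  exact: integral_cauchy_kernel_le.
- apply/(measurable_restrictT _ _).1 => //.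
  by apply/measurable_EFinP; exact: measurable_funTS.
- by move=> x _; apply: erestrict_ge0 => y _; rewrite lee_fin.
- by rewrite lee_fin mulr_ge0// ltW.
Qed.
End StripIntegral.

Section AreaKernel.
Context {R : realType}.
Local Notation mu := (@lebesgue_measure R).
Implicit Types (lam z : R[i]) (a al b s : R) (p : R * R).

Definition disc_plane : set (R * R) := of_plane @^-1` disc.

(* As [|lam| = 1], one of its coordinates has modulus at least [1 / 2]; slicing a
   strip along that coordinate gives sections of length comparable to [al]. *)
Definition strip_weight lam al b p : R :=
  if 2^-1 <= `|complex.Im lam| then
    strip_kernel (complex.Re lam) 1 (complex.Im lam) al (complex.Re lam) b p
  else
    strip_kernel (complex.Im lam) 1 (complex.Re lam) al (complex.Im lam) b (p.2, p.1).

Lemma measurable_strip_weight lam al b : measurable_fun setT (strip_weight lam al b).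
Proof.
rewrite /strip_weight; case: (_ <= `|_|); first exact: measurable_strip_kernel.
apply: measurableT_comp; first exact: measurable_strip_kernel.
exact: measurable_swap.
Qed.

Lemma strip_weight_ge0 lam al b p : 0 <= strip_weight lam al b p.
Proof. by rewrite /strip_weight; case: (_ <= `|_|); exact: strip_kernel_ge0. Qed.

Lemma integral_strip_weight_le lam al b : modulus lam = 1 -> 0 < al -> 0 < b ->
  (\int[(mu \x mu)%E]_p (strip_weight lam al b p)%:E <= (2 * al * (pi / b))%:E)%E.
Proof.
move=> lam1 al0 b0; have m := measurable_strip_weight lam al b.
have h := sqr_modulus lam; rewrite lam1 expr1n in h.
rewrite /strip_weight in m *; case: (boolP (_ <= `|_|)) m => [c2|c2] m.
- rewrite fubini_tonelli1//=.
  + exact: iterated_integral_strip_kernel_le.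
  + exact/measurable_EFinP.
  + by move=> p; rewrite lee_fin strip_kernel_ge0.
(* Here [|Im lam| < 1/2], so [|Re lam| >= 1/2] because the squares add up to 1; the other order of
   integration matches the swapped coordinates. *)
- rewrite fubini_tonelli2//=.
  + apply: iterated_integral_strip_kernel_le => //.
    move: c2; rewrite -!ltNge => c2; rewrite leNgt; apply/negP => c3.
    have := normr_ge0 (complex.Re lam); have := normr_ge0 (complex.Im lam).
    rewrite -(real_normK (num_real (complex.Re lam))) in h.
    rewrite -(real_normK (num_real (complex.Im lam))) in h.
    nra.
  + exact/measurable_EFinP.
  + by move=> p; rewrite lee_fin strip_kernel_ge0.
Qed.

(** The 8 is 4 times 2. The weight gives 4: [1 - |z|^2 <= 2 (1 - |z|) <= 2 Re w <= 4 al], and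
    [(4 al)^s <= 4 al^s]. The kernel gives 2: [|a + w|^2] is at least [(a + al)^2] and, being at
    least [|w|^2 = |z - lam|^2], at least the square of each coordinate of [z - lam], hence at least
    half the sum of the two bounds. *)
Lemma kernel_le_strip s a lam al p : 0 < s < 1 -> 0 < a -> modulus lam = 1 ->
  0 < al -> disc_plane p ->
  al < complex.Re (wfac lam (of_plane p)) <= 2 * al ->
  (1 - modulus (of_plane p) ^+ 2) `^ s * pole_kernel a lam (of_plane p) <=
  8 * (al `^ s / al) * strip_weight lam al (a + al) p.
Proof.
move=> /andP[s0 s1] a0 lam1 al0 /discE.
case: p lam lam1 => [x y] [c d] lam1.
have h := sqr_modulus (c +i* d); rewrite lam1 expr1n/= in h.
set z := of_plane (x, y) => z1 U.
have Re_wfac_ge_gap := Re_wfac_ge z lam1.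
have z0 := modulus_ge0 z.
set u := complex.Re (wfac (c +i* d) z) in U Re_wfac_ge_gap *.
have uE : u = 1 - c * x - d * y by rewrite /u /wfac/=; ring.
have zE : modulus z ^+ 2 = x ^+ 2 + y ^+ 2 by rewrite sqr_modulus.
have two_s : 2 `^ s <= 2 :> R.
  by rewrite -[leRHS]powRr1// ler_powR ?ler1n// ltW.
have weight_le : (1 - modulus z ^+ 2) `^ s <= 4 * al `^ s.
  apply: (@le_trans _ _ ((2 * 2 * al) `^ s)).
    rewrite ge0_ler_powR ?nnegrE ?(ltW s0)//; last by move: U => /andP[]; nra.
    - nra.
    - by nra.
  rewrite !powRM ?mulr_ge0 ?(ltW al0)//; apply: ler_wpM2r; first exact: powR_ge0.
  have := powR_ge0 2 s; nra.
pose W := modulus (a%:C + wfac (c +i* d) z) ^+ 2.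
have WE : W = (a + u) ^+ 2 + (d * x - c * y) ^+ 2.
  by rewrite /W sqr_modulus /wfac/= uE; ring.
rewrite /pole_kernel -/u -/W; clearbody W.
have geo : (a + u) ^+ 2 + (d * x - c * y) ^+ 2 >= u ^+ 2 + (d * x - c * y) ^+ 2.
  by move: U => /andP[]; nra.
(* Both sides are the square of [|1 - conj(lam) z| = |z - lam|]. *)
have geoE : u ^+ 2 + (d * x - c * y) ^+ 2 = (x - c) ^+ 2 + (y - d) ^+ 2.
  have -> : (x - c) ^+ 2 + (y - d) ^+ 2 =
    x ^+ 2 + y ^+ 2 - 2 * (c * x + d * y) + (c ^+ 2 + d ^+ 2) by ring.
  rewrite -h uE.
  have -> : (1 - c * x - d * y) ^+ 2 + (d * x - c * y) ^+ 2 =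
    1 - 2 * (c * x + d * y) + (c ^+ 2 + d ^+ 2) * (x ^+ 2 + y ^+ 2) by ring.
  by rewrite -h; ring.
(* [t] stands for [x - c] or [y - d], according to the direction of slicing. *)
have main (t : R) : t ^+ 2 <= (x - c) ^+ 2 + (y - d) ^+ 2 ->
    (1 - modulus z ^+ 2) `^ s * (u * W)^-1 <=
    8 * (al `^ s / al) * ((a + al) ^+ 2 + t ^+ 2)^-1.
  move=> t2; move/andP : U => [U1 U2].
  have u0 : 0 < u by lra.
  have aal : (a + al) ^+ 2 <= (a + u) ^+ 2 by nra.
  have aal0 : 0 < (a + al) ^+ 2 + t ^+ 2.
    by rewrite ltr_pwDl ?sqr_ge0// exprn_gt0// addr_gt0.
  have W2 : (a + al) ^+ 2 + t ^+ 2 <= 2 * W.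
    rewrite WE; have := sqr_ge0 (d * x - c * y); lra.
  have W0 : 0 < W by lra.
  have -> : 8 * (al `^ s / al) * ((a + al) ^+ 2 + t ^+ 2)^-1 =
    (4 * al `^ s) * (al * (((a + al) ^+ 2 + t ^+ 2) / 2))^-1.
    by field; rewrite !gt_eqF.
  apply: ler_pM => //; first exact: powR_ge0.
    by rewrite invr_ge0 mulr_ge0// ltW.
  rewrite lef_pV2 ?posrE ?mulr_gt0// ?invr_gt0//.
  by apply: ler_pM => //; [exact: ltW|rewrite divr_ge0// ltW|exact: ltW|lra].
have xy1 : x ^+ 2 + y ^+ 2 < 1 by rewrite -zE; nra.
have xb : -1 <= x <= 1 by apply/andP; split; nra.
have yb : -1 <= y <= 1 by apply/andP; split; nra.
rewrite /strip_weight /strip_kernel; case: (2^-1 <= `|complex.Im (c +i* d)|).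
- rewrite indicE mem_set; last first.
    by rewrite /strip/= xb/= -uE.
  by rewrite mul1r main// lerDl sqr_ge0.
- rewrite indicE mem_set; last first.
    by rewrite /strip/= yb/= (_ : 1 - d * y - c * x = u)// uE; ring.
  by rewrite mul1r main// lerDr sqr_ge0.
Qed.

End AreaKernel.

(** * Summation over the dyadic strips *)

Section DyadicSum.
Context {R : realType}.
Local Notation mu := (@lebesgue_measure R).
Implicit Types (lam z : R[i]) (a al b s : R) (p : R * R).

(** The integer exponents are split into two families indexed by [nat], below and above the scale
    [a]. In each case the least admissible [k] is taken: minimality gives the missing inequality,
    and for [k = 0] the comparison of [u] with [a] does. *)
Lemma dyadic_cover a (u : R) : 0 < a -> 0 < u ->
  exists k, (a / 2 ^+ k.+1 < u <= 2 * (a / 2 ^+ k.+1)) \/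
            (a * 2 ^+ k < u <= 2 * (a * 2 ^+ k)).
Proof.
move=> a0 u0.
have big (x : R) : exists n, x < 2 ^+ n.
  exists (Num.bound `|x|); apply: le_lt_trans (ler_norm x) _.
  apply: lt_le_trans (archi_boundP (normr_ge0 x)) _.
  by rewrite -natrX ler_nat ltnW// ltn_expl.
have p0 n : 0 < 2 ^+ n :> R by rewrite exprn_gt0.
have [ua|au] := leP u a.
- have ex : exists n, a / 2 ^+ n.+1 < u.
    have [n hn] := big (a / u); exists n.
    rewrite ltr_pdivrMr// mulrC -ltr_pdivrMr//; apply: lt_le_trans hn _.
    by rewrite ler_eXn2l ?ltr1n.
  have [k hk kmin] := ex_minnP ex; exists k; left; rewrite hk/=.
  have -> : 2 * (a / 2 ^+ k.+1) = a / 2 ^+ k.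
    by rewrite exprS; field; rewrite gt_eqF.
  case: k hk kmin => [|k] _ kmin; first by rewrite expr0 divr1.
  by rewrite leNgt; apply/negP => /kmin; rewrite ltnn.
- have ex : exists n, u <= 2 * (a * 2 ^+ n).
    have [n hn] := big (u / a); exists n.
    by move: hn; rewrite ltr_pdivrMr// => hn; have := p0 n; nra.
  have [k hk kmin] := ex_minnP ex; exists k; right; rewrite hk andbT.
  case: k hk kmin => [|k] _ kmin; first by rewrite expr0 mulr1.
  rewrite ltNge; apply/negP => h.
  have := kmin k; rewrite ltnn => H; apply: notF; apply: H.
  by move: h; rewrite exprS mulrCA.
Qed.

Lemma nneseries_EFin (x : nat -> R) : cvgn (series x) ->
  (\sum_(k <oo) (x k)%:E)%E = (limn (series x))%:E.
Proof.
move=> cx; rewrite -EFin_lim//; congr (limn _).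
by apply/funext => n /=; rewrite /series/= sumEFin.
Qed.

Definition strip_term s a lam al p : R :=
  8 * (al `^ s / al) * strip_weight lam al (a + al) p.

Lemma strip_term_ge0 s a lam al p : 0 < al -> 0 <= strip_term s a lam al p.
Proof.
by move=> al0; rewrite !mulr_ge0 ?strip_weight_ge0 ?powR_ge0// invr_ge0 ltW.
Qed.

Lemma measurable_strip_term s a lam al : measurable_fun setT (strip_term s a lam al).
Proof. by apply: measurable_funM => //; exact: measurable_strip_weight. Qed.

Lemma integral_strip_term_le s a lam al : modulus lam = 1 -> 0 < a -> 0 < al ->
  (\int[(mu \x mu)%E]_p (strip_term s a lam al p)%:E <=
   (16 * pi * (al `^ s / (a + al)))%:E)%E.
Proof.
move=> lam1 a0 al0.
have c0 : 0 <= 8 * (al `^ s / al) :> R by rewrite mulr_ge0// divr_ge0 ?powR_ge0// ltW.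
under eq_integral do rewrite /strip_term EFinM.
rewrite ge0_integralZl ?lee_fin//=; last 2 first.
- by apply/measurable_EFinP; exact: measurable_strip_weight.
- by move=> p _; rewrite lee_fin strip_weight_ge0.
apply: (@le_trans _ _ ((8 * (al `^ s / al))%:E * (2 * al * (pi / (a + al)))%:E)%E).
  by rewrite lee_wpmul2l ?lee_fin// integral_strip_weight_le// addr_gt0.
rewrite -EFinM lee_fin le_eqVlt; apply/orP; left; apply/eqP; field.
by rewrite !gt_eqF// addr_gt0.
Qed.

(** One geometric series for the scales [a / 2^(k+1)], of ratio [2^(-s)], and one for the scales
    [a 2^k], of ratio [2^s / 2]; they converge because [1 < 2^s < 2]. The factor [16 pi] comes from
    [integral_strip_term_le]. *)
Definition dyadic_const s : R :=
  16 * pi * (limn (series (geometric (1 : R) (2 `^ s)^-1)) +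
             limn (series (geometric (1 : R) (2 `^ s / 2)))).

Lemma powR_exp2 s k : ((2 : R) ^+ k) `^ s = (2 `^ s) ^+ k.
Proof.
elim: k => [|k IH]; first by rewrite !expr0 powR1.
by rewrite !exprS powRM ?exprn_ge0// IH.
Qed.

Lemma measurable_disc_plane : measurable (disc_plane : set (R * R)).
Proof.
have m1 : measurable_fun setT (fun p : R * R => p.1) by exact: measurable_fst.
have m2 : measurable_fun setT (fun p : R * R => p.2) by exact: measurable_snd.
have m : measurable_fun setT (fun p : R * R => p.1 ^+ 2 + p.2 ^+ 2 < 1).
  by apply: measurable_fun_ltr => //; apply: measurable_funD; apply: measurable_funX.
have := m measurableT [set true]; rewrite setTI => /(_ I) H.
rewrite (_ : disc_plane = (fun p : R * R => p.1 ^+ 2 + p.2 ^+ 2 < 1) @^-1` [set true])//.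
apply/seteqP; split => -[x y] /=.
- move=> /discE h; have := sqr_modulus (of_plane (x, y)); rewrite /= => <-.
  by rewrite expr_lt1// modulus_ge0.
- have := sqr_modulus (of_plane (x, y)); rewrite /= => <- h; apply/discE.
  by rewrite -(@expr_lt1 _ 2)// modulus_ge0.
Qed.

Lemma measurable_weighted_kernel s a lam : 0 < a -> modulus lam = 1 ->
  measurable_fun disc_plane (fun p =>
    (1 - modulus (of_plane p) ^+ 2) `^ s * pole_kernel a lam (of_plane p)).
Proof.
move=> a0 lam1.
have m1 : measurable_fun disc_plane (fun p : R * R => p.1).
  by apply: measurable_funTS; exact: measurable_fst.
have m2 : measurable_fun disc_plane (fun p : R * R => p.2).
  by apply: measurable_funTS; exact: measurable_snd.
apply: measurable_funM.
  apply: (measurableT_comp (measurable_powR s)).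
  under eq_fun do rewrite sqr_modulus/=.
  by apply: measurable_funB => //; apply: measurable_funD; apply: measurable_funX.
apply: measurable_funV.
  under eq_fun do rewrite sqr_modulus /wfac/=.
  case: lam lam1 => c d _ /=.
  by repeat first [apply: measurable_funM | apply: measurable_funD |
    apply: measurable_funX | exact: measurable_cst | exact: m1 | exact: m2 |
    apply: measurable_oppr | apply: measurable_funN].
move=> p /discE z1; rewrite mulr_ge0 ?sqr_ge0//.
by apply: le_trans (Re_wfac_ge _ lam1); rewrite subr_ge0 ltW.
Qed.

Lemma integral_weighted_kernel_le s a lam : 0 < s < 1 -> 0 < a -> modulus lam = 1 ->
  (\int[(mu \x mu)%E]_(p in disc_plane)
     ((1 - modulus (of_plane p) ^+ 2) `^ s * pole_kernel a lam (of_plane p))%:E <=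
   (dyadic_const s * (a `^ s / a))%:E)%E.
Proof.
move=> s01 a0 lam1; have /andP[s0 s1] := s01.
pose al k : R := a / 2 ^+ k.+1; pose be k : R := a * 2 ^+ k.
have p0 n : 0 < 2 ^+ n :> R by rewrite exprn_gt0.
have al0 k : 0 < al k by rewrite divr_gt0.
have be0 k : 0 < be k by rewrite mulr_gt0.
pose t k p := (strip_term s a lam (al k) p)%:E + (strip_term s a lam (be k) p)%:E.
have t0 k p : (0 <= t k p)%E.
  by rewrite adde_ge0// lee_fin strip_term_ge0.
have mt k : measurable_fun setT (t k).
  by apply: emeasurable_funD; apply/measurable_EFinP; exact: measurable_strip_term.
(* Each point of the disc lies in a strip of one of the families, whose term alone dominates the
   kernel there; the remaining terms are nonnegative. *)
apply: (@le_trans _ _ (\int[(mu \x mu)%E]_(p in disc_plane) (\sum_(k <oo) t k p))%E).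
  apply: ge0_le_integral => //.
  - exact: measurable_disc_plane.
  - move=> p /discE z1; rewrite lee_fin mulr_ge0 ?powR_ge0// invr_ge0.
    rewrite mulr_ge0 ?sqr_ge0//.
    by apply: le_trans (Re_wfac_ge _ lam1); rewrite subr_ge0 ltW.
  - by apply/measurable_EFinP; exact: measurable_weighted_kernel.
  - apply: ge0_emeasurable_sum => [k p _ _|k _]; first exact: t0.
    by apply: measurable_funTS; exact: mt.
  - move=> p Dp; have /discE z1 := Dp.
    have u0 : 0 < complex.Re (wfac lam (of_plane p)).
      by apply: lt_le_trans (Re_wfac_ge _ lam1); rewrite subr_gt0.
    have [k hk] := dyadic_cover a0 u0.
    apply: (@le_trans _ _ (t k p)).
      rewrite /t; case: hk => hk.
      - apply: (@le_trans _ _ (strip_term s a lam (al k) p)%:E).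
          by rewrite lee_fin; exact: kernel_le_strip.
        by rewrite leeDl// lee_fin strip_term_ge0.
      - apply: (@le_trans _ _ (strip_term s a lam (be k) p)%:E).
          by rewrite lee_fin; exact: kernel_le_strip.
        by rewrite leeDr// lee_fin strip_term_ge0.
    have := @nneseries_lim_ge R (fun k => t k p) xpredT 0 k.+1 (fun n _ _ => t0 n p).
    apply: le_trans; rewrite big_nat_recr//= leeDr// sume_ge0//.
rewrite integral_nneseries//=; last 2 first.
- exact: measurable_disc_plane.
- by move=> k; apply: measurable_funTS; exact: mt.
pose Q : R := 2 `^ s.
have ln2 : 0 < ln (2 : R) by rewrite ln_gt0// ltr1n.
have QE : Q = expR (s * ln 2) by rewrite /Q /powR gt_eqF.
have Q1 : 1 < Q by rewrite QE expR_gt1 mulr_gt0.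
have Q2 : Q < 2.
  rewrite QE -[X in _ < X]lnK ?posrE// ltr_expR.
  by rewrite -[X in _ < X]mul1r ltr_pM2r.
have Q0 : 0 < Q by rewrite (lt_trans _ Q1).
have c1 : cvgn (series (geometric (1 : R) Q^-1)).
  by apply: is_cvg_geometric_series; rewrite ger0_norm ?invr_ge0 ?ltW// invf_lt1.
have c2 : cvgn (series (geometric (1 : R) (Q / 2))).
  apply: is_cvg_geometric_series; rewrite ger0_norm ?divr_ge0 ?(ltW Q0)//.
  by rewrite ltr_pdivrMr// mul1r.
pose x k := 16 * pi * (a `^ s / a) * (geometric 1 Q^-1 k + geometric 1 (Q / 2) k).
have sx : series x = (fun n => 16 * pi * (a `^ s / a) *
    (series (geometric 1 Q^-1) n + series (geometric 1 (Q / 2)) n)).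
  by apply/funext => n; rewrite /series/= /x -mulr_sumr big_split.
have cx : series x @ \oo --> dyadic_const s * (a `^ s / a).
  rewrite [X in _ --> X]mulrAC sx; apply: cvgMr.
  by apply: cvgD.
apply: (@le_trans _ _ (\sum_(k <oo) (x k)%:E)%E).
  apply: lee_nneseries => [k _ _|k _]; first by apply: integral_ge0 => p _.
  apply: (@le_trans _ _ (\int[(mu \x mu)%E]_p t k p)%E).
    apply: (@ge0_subset_integral _ _ _ (mu \x mu)%E disc_plane setT) => //.
    + exact: measurable_disc_plane.
    + exact: mt.
  rewrite /t ge0_integralD//=; last 4 first.
  - by move=> p _; rewrite lee_fin strip_term_ge0.
  - by apply/measurable_EFinP; exact: measurable_strip_term.
  - by move=> p _; rewrite lee_fin strip_term_ge0.
  - by apply/measurable_EFinP; exact: measurable_strip_term.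
  apply: (le_trans (leeD (integral_strip_term_le s lam1 a0 (al0 k))
    (integral_strip_term_le s lam1 a0 (be0 k)))).
  rewrite -EFinD lee_fin /x -mulrDr -[leRHS]mulrA ler_wpM2l//.
    by rewrite mulr_ge0// pi_ge0.
  rewrite mulrDr; apply: lerD.
  (* Scales below [a]: the denominator [a + al k] is at least [a], and one factor [Q^-1 <= 1] is
     dropped. *)
  - rewrite /geometric/= mul1r.
    have -> : al k `^ s = a `^ s * Q^-1 ^+ k.+1.
      rewrite /al powRM ?invr_ge0 ?ltW//; congr (_ * _).
      apply: (mulIf (x := Q ^+ k.+1)); first by rewrite gt_eqF// exprn_gt0.
      rewrite -exprMn mulVf ?gt_eqF// expr1n /Q -powR_exp2 -powRM ?invr_ge0 ?ltW//.
      by rewrite mulVf ?gt_eqF// powR1.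
    rewrite [leRHS]mulrAC; apply: ler_pM.
    + by rewrite mulr_ge0 ?powR_ge0// exprn_ge0// invr_ge0 ltW.
    + by rewrite invr_ge0 addr_ge0 ?ltW.
    + rewrite ler_wpM2l ?powR_ge0// exprS ler_piMl ?exprn_ge0 ?invr_ge0 ?(ltW Q0)//.
      by rewrite invf_le1 ?ltW.
    + by rewrite lef_pV2 ?posrE ?addr_gt0// lerDl ltW.
  (* Scales above [a]: the denominator [a + be k] is at least [a 2^k], hence the ratio [Q / 2]. *)
  - rewrite /geometric/= mul1r /be powRM ?(ltW a0) ?(ltW (p0 k))// powR_exp2 -/Q.
    have -> : a `^ s / a * (Q / 2) ^+ k = a `^ s * Q ^+ k * (a * 2 ^+ k)^-1.
      by rewrite expr_div_n; field; rewrite !gt_eqF.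
    rewrite ler_wpM2l ?mulr_ge0 ?powR_ge0 ?exprn_ge0 ?(ltW Q0)//.
    by rewrite lef_pV2 ?posrE ?addr_gt0 ?mulr_gt0// lerDr (ltW a0).
by rewrite nneseries_EFin ?(cvg_lim _ cx)//; exact: cvgP cx.
Qed.

End DyadicSum.

(** * The Herglotz integral of an atomic measure *)

Section CircleIntegral.
Context {R : realType} (a : nat -> {posnum R}) (l : nat -> R[i]).
Context (l1 : forall n, circle (l n)) (ca : cvgn (series (fun n => (a n)%:num))).
Implicit Types (z : R[i]).

Definition circle_plane : set (R * R) := of_plane @^-1` circle.

Lemma measurable_circle_plane : measurable circle_plane.
Proof.
have m1 : measurable_fun setT (fun p : R * R => p.1) by exact: measurable_fst.
have m2 : measurable_fun setT (fun p : R * R => p.2) by exact: measurable_snd.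
have m : measurable_fun setT (fun p : R * R => p.1 ^+ 2 + p.2 ^+ 2).
  by apply: measurable_funD; apply: measurable_funX.
have := m measurableT [set 1]; rewrite setTI => /(_ (measurable_set1 1)) H.
rewrite (_ : circle_plane = (fun p : R * R => p.1 ^+ 2 + p.2 ^+ 2) @^-1` [set 1])//.
apply/seteqP; split => -[x y] /=.
- move=> /circleE h; have := sqr_modulus (of_plane (x, y)); rewrite /= => <-.
  by rewrite h expr1n.
- have := sqr_modulus (of_plane (x, y)); rewrite /= => <- h; apply/circleE.
  by apply/eqP; rewrite -sqrp_eq1 ?modulus_ge0// h.
Qed.

Lemma circle_plane_atom n : circle_plane (to_plane (l n)).
Proof. by rewrite /circle_plane/= /of_plane/to_plane/=; case: (l n) (l1 n). Qed.

Lemma cvgn_bounded_series (f : R * R -> R) M :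
  (forall p, circle_plane p -> `|f p| <= M) ->
  cvgn (series (fun n => (a n)%:num * f (to_plane (l n)))).
Proof.
move=> fM; apply: (@cvgn_increments _ _ (fun n => M * (a n)%:num)).
  move=> n; rewrite -[X in `|X|]/(series _ n.+1 - series _ n) seriesSB.
  rewrite normrM ger0_norm// mulrC ler_wpM2r//; exact/fM/circle_plane_atom.
exact: is_cvg_seriesZ.
Qed.

Lemma ge0_integral_atomic_measure (f : R * R -> R) M :
  measurable_fun circle_plane f ->
  (forall p, circle_plane p -> 0 <= f p <= M) ->
  (\int[atomic_measure a l]_(p in circle_plane) (f p)%:E =
   (limn (series (fun n => (a n)%:num * f (to_plane (l n)))))%:E)%E.
Proof.
move=> mf f0.
have mC := measurable_circle_plane.
rewrite ge0_integral_measure_series//=; last 2 first.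
- by move=> p /f0 /andP[h _]; rewrite lee_fin.
- exact/measurable_EFinP.
rewrite -nneseries_EFin; last first.
  apply: (@cvgn_bounded_series _ M) => p /f0 /andP[h1 h2].
  by rewrite ger0_norm.
apply: eq_eseriesr => n _.
rewrite ge0_integral_mscale//=; last 2 first.
- exact/measurable_EFinP.
- by move=> p /f0 /andP[h _]; rewrite lee_fin.
rewrite integral_dirac//; last exact/measurable_EFinP.
by rewrite diracE mem_set ?mul1e -?EFinM//; exact: circle_plane_atom.
Qed.

Lemma cvg_Rintegral_atomic_measure (f : R * R -> R) M :
  measurable_fun circle_plane f ->
  (forall p, circle_plane p -> `|f p| <= M) ->
  series (fun n => (a n)%:num * f (to_plane (l n))) @ \oo -->
    Rintegral (atomic_measure a l) circle_plane f.
Proof.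
move=> mf fM.
(* The formula for a series of measures concerns nonnegative integrands. Both parts inherit the
   bound [M], so their integrals are finite and can be subtracted. *)
pose fp p := Num.max (f p) 0; pose fm p := Num.max (- f p) 0.
have fpM p : circle_plane p -> 0 <= fp p <= M.
  move=> /fM; rewrite ler_norml => /andP[h1 h2].
  by rewrite /fp le_max lexx orbT/= ge_max h2/=; lra.
have fmM p : circle_plane p -> 0 <= fm p <= M.
  move=> /fM; rewrite ler_norml => /andP[h1 h2].
  by rewrite /fm le_max lexx orbT/= ge_max; apply/andP; split; lra.
have mfp : measurable_fun circle_plane fp by apply: measurable_maxr.
have mfm : measurable_fun circle_plane fm.
  by apply: measurable_maxr => //; exact: measurableT_comp.
have -> : Rintegral (atomic_measure a l) circle_plane f =
    limn (series (fun n => (a n)%:num * fp (to_plane (l n)))) -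
    limn (series (fun n => (a n)%:num * fm (to_plane (l n)))).
  rewrite /Rintegral integralE.
  rewrite (_ : integral _ _ _ =
      \int[atomic_measure a l]_(p in circle_plane) (fp p)%:E)%E; last first.
    by apply: eq_integral => p _; rewrite funeposE/= EFin_max.
  rewrite (_ : integral _ _ (_ ^\-)%E =
      \int[atomic_measure a l]_(p in circle_plane) (fm p)%:E)%E; last first.
    by apply: eq_integral => p _; rewrite funenegE/= EFin_max.
  by rewrite (ge0_integral_atomic_measure mfp fpM) (ge0_integral_atomic_measure mfm fmM).
have -> : series (fun n => (a n)%:num * f (to_plane (l n))) = (fun N =>
    series (fun n => (a n)%:num * fp (to_plane (l n))) N -
    series (fun n => (a n)%:num * fm (to_plane (l n))) N).
  apply/funext => N; rewrite /series/= -sumrB; apply: eq_bigr => n _.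
  rewrite -mulrBr; congr (_ * _); rewrite /fp /fm.
  by case: (leP (f _) 0) => h; [rewrite max_l|rewrite max_r]; lra.
have bnd (g : R * R -> R) : (forall p, circle_plane p -> 0 <= g p <= M) ->
    forall p, circle_plane p -> `|g p| <= M.
  by move=> gM p /gM /andP[h1 h2]; rewrite ger0_norm.
by apply: cvgB; apply: (@cvgn_bounded_series _ M); exact: bnd.
Qed.

Lemma circle_integral_atomic_measure z : modulus z < 1 ->
  circle_integral (atomic_measure a l) (fun w => (w + z) / (w - z)) =
  herglotz (fun n => (a n)%:num) l z.
Proof.
move=> z1.
have d0 : 0 < 1 - modulus z by rewrite subr_gt0.
have far p : circle_plane p -> 1 - modulus z <= modulus (of_plane p - z).
  move=> /circleE p1; have := modulusD (of_plane p - z) z.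
  by rewrite subrK p1; lra.
have qM p : circle_plane p ->
    modulus ((of_plane p + z) / (of_plane p - z)) <= 2 * (1 - modulus z)^-1.
  move=> Cp; rewrite modulusM modulusV; apply: ler_pM.
  - exact: modulus_ge0.
  - by rewrite invr_ge0 modulus_ge0.
  - by have := modulusD (of_plane p) z; move/circleE: Cp => ->; lra.
  - by rewrite lef_pV2 ?posrE ?far// (lt_le_trans d0)// far.
have m1 : measurable_fun circle_plane (fun p : R * R => p.1).
  by apply: measurable_funTS; exact: measurable_fst.
have m2 : measurable_fun circle_plane (fun p : R * R => p.2).
  by apply: measurable_funTS; exact: measurable_snd.
(* Complex division unfolds to division by this sum of squares, the only non-polynomial ingredient
   of the real and imaginary parts below. *)
have mV : measurable_fun circle_plane (fun p : R * R =>
    ((p.1 - complex.Re z) ^+ 2 + (p.2 - complex.Im z) ^+ 2)^-1).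
  apply: measurable_funV => [|p _]; last by rewrite addr_ge0 ?sqr_ge0.
  by apply: measurable_funD; apply: measurable_funX; apply: measurable_funB.
have mN (g : R * R -> R) : measurable_fun circle_plane g ->
    measurable_fun circle_plane (fun p => - g p).
  by move=> mg; exact: measurableT_comp.
have mRe : measurable_fun circle_plane (fun p =>
    complex.Re ((of_plane p + z) / (of_plane p - z))).
  case: z mV {z1 d0 far qM} => x y /= mV.
  by repeat first [exact: mV | exact: m1 | exact: m2 | exact: measurable_cst |
    apply: measurable_funB | apply: measurable_funD | apply: measurable_funM |
    apply: mN].
have mIm : measurable_fun circle_plane (fun p =>
    complex.Im ((of_plane p + z) / (of_plane p - z))).
  case: z mV {z1 d0 far qM mRe} => x y /= mV.
  by repeat first [exact: mV | exact: m1 | exact: m2 | exact: measurable_cst |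
    apply: measurable_funB | apply: measurable_funD | apply: measurable_funM |
    apply: mN].
have cRe := cvg_Rintegral_atomic_measure mRe
  (fun p Cp => le_trans (normr_Re_le _) (qM p Cp)).
have cIm := cvg_Rintegral_atomic_measure mIm
  (fun p Cp => le_trans (normr_Im_le _) (qM p Cp)).
apply/esym/cvgC_limC.
(* As [l conj(l) = 1], the denominator is [l w] and the numerator [l (2 - w)]. *)
have term n : (of_plane (to_plane (l n)) + z) / (of_plane (to_plane (l n)) - z) =
    2 * (wfac (l n) z)^-1 - 1.
  have -> : of_plane (to_plane (l n)) = l n by case: (l n).
  have ln1 : modulus (l n) = 1 by exact/circleE.
  have ll : l n * (l n)^* = 1.
    by rewrite -sqr_normc normr_modulus ln1 expr1n.
  have w0 := wfac_neq0 ln1 z1.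
  have l0 : l n != 0 by rewrite -modulus_eq0 ln1 oner_eq0.
  have -> : l n - z = l n * wfac (l n) z.
    by rewrite /wfac mulrBr mulr1 mulrA ll mul1r.
  have -> : l n + z = l n * (2 - wfac (l n) z).
    by rewrite /wfac mulrBr mulrBr mulrA ll; ring.
  by field; rewrite w0 l0.
split.
- rewrite (_ : (fun N => complex.Re (herglotz_part _ _ N z)) =
  series (fun n => (a n)%:num *
    complex.Re ((of_plane (to_plane (l n)) + z) / (of_plane (to_plane (l n)) - z)))).
    exact: cRe.
  apply/funext => N; rewrite /herglotz_part /series/= big_mkord.
  rewrite (big_morph (@complex.Re R) (@Re_addc R) (erefl : complex.Re 0 = 0)).
  by apply: eq_bigr => n _; rewrite term Re_mulc/= mul0r subr0.
- rewrite (_ : (fun N => complex.Im (herglotz_part _ _ N z)) =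
  series (fun n => (a n)%:num *
    complex.Im ((of_plane (to_plane (l n)) + z) / (of_plane (to_plane (l n)) - z)))).
    exact: cIm.
  apply/funext => N; rewrite /herglotz_part /series/= big_mkord.
  rewrite (big_morph (@complex.Im R) (@Im_addc R) (erefl : complex.Im 0 = 0)).
  by apply: eq_bigr => n _; rewrite term Im_mulc/= mul0r addr0.
Qed.

End CircleIntegral.

(** * Bounded functions in the Hardy space, summability, and the final assembly *)

Section IntegralMonotone.
Context d (T : measurableType d) (R : realType) (mu : {measure set T -> \bar R}).
Local Open Scope ereal_scope.

(** A nonnegative integral is the supremum over the simple functions below the integrand, a set that
    grows with it. This serves for integrands built from [cderive] or from an arbitrary bounded
    function. *)
Lemma ge0_le_integral_nomeasurable (D : set T) (f g : T -> \bar R) :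
  (forall x, D x -> 0 <= f x) -> (forall x, D x -> f x <= g x) ->
  \int[mu]_(x in D) f x <= \int[mu]_(x in D) g x.
Proof.
move=> f0 fg.
have g0 x : D x -> 0 <= g x by move=> Dx; exact: le_trans (f0 x Dx) (fg x Dx).
rewrite !ge0_integralE//; apply: le_ereal_sup => _ /= [h hf <-].
exists h => // x; apply: le_trans (hf x) _.
by rewrite /patch; case: ifPn => [/[!inE]/fg|].
Qed.

End IntegralMonotone.

Section H2Bound.
Context {R : realType}.

Lemma H2_sqnorm_bounded (f : R[i] -> R[i]) (M : R) :
  (forall z, modulus z < 1 -> modulus (f z) <= M) -> (H2_sqnorm f < +oo)%E.
Proof.
move=> fM; apply: (@le_lt_trans _ _ (M ^+ 2)%:E); last exact: ltry.
apply: ub_ereal_sup => _ /= [r /andP[r0 r1] <-].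
have pi2 : 0 < 2 * pi :> R by rewrite mulr_gt0// pi_gt0.
apply: (@le_trans _ _ ((2 * pi)^-1%:E *
   \int[lebesgue_measure]_(t in `[0%R, (2 * pi)%R]) (M ^+ 2)%:E)%E).
  rewrite lee_wpmul2l ?lee_fin ?invr_ge0 ?(ltW pi2)//.
  apply: ge0_le_integral_nomeasurable => t _; rewrite lee_fin ?sqr_ge0//.
  set z := _ * _.
  have z1 : modulus z < 1.
    rewrite /z modulusM modulus_real ger0_norm// modulusE/= cos2Dsin2 sqrtr1.
    by rewrite mulr1.
  by rewrite ler_pXn2r ?nnegrE ?modulus_ge0 ?fM// (le_trans (modulus_ge0 _) (fM _ z1)).
rewrite integral_cst//= lebesgue_measure_itv/= lte_fin pi2 -EFinD subr0 -!EFinM.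
by rewrite lee_fin mulrCA mulVf ?mulr1// gt_eqF.
Qed.

End H2Bound.

Section Summability.
Context {R : realType}.

(** Write [a = (a^s)^(1/s - 1) a^s]: the exponent [1/s - 1] is nonnegative and [a^s] is bounded by
    its sum [B], so [a <= B^(1/s - 1) a^s]. *)
Lemma summable_of_powR (s : R) (a : nat -> R) : 0 < s < 1 -> (forall n, 0 < a n) ->
  cvgn (series (fun n => a n `^ s)) -> cvgn (series a).
Proof.
move=> /andP[s0 s1] a0 cs.
pose B := limn (series (fun n => a n `^ s)).
have aB n : a n `^ s <= B.
  have := series_ge0_le (fun n => powR_ge0 (a n) s) cs n.+1.
  apply: le_trans; rewrite big_ord_recr/= lerDr sumr_ge0// => i _.
  exact: powR_ge0.
have e0 : 0 <= s^-1 - 1 by rewrite subr_ge0 invf_ge1// ltW.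
apply: (@series_le_cvg _ a (fun n => B `^ (s^-1 - 1) * a n `^ s)).
- by move=> n; exact: ltW.
- by move=> n; rewrite mulr_ge0 ?powR_ge0.
- move=> n; have E : a n = (a n `^ s) `^ (s^-1 - 1) * a n `^ s.
    rewrite -[X in _ * X]powRr1 ?powR_ge0// -powRD; last first.
      by apply/implyP => _; rewrite gt_eqF// powR_gt0.
    by rewrite subrK -powRrM mulfV ?gt_eqF// powRr1 ?ltW.
  rewrite [leLHS]E.
  rewrite ler_wpM2r ?powR_ge0// ge0_ler_powR ?nnegrE ?powR_ge0//.
  exact: le_trans (powR_ge0 _ _) (aB n).
- exact: is_cvg_seriesZ.
Qed.

End Summability.

Section HolomorphicOnDisc.
Context {R : realType}.
Implicit Types (f g : R[i] -> R[i]) (z v : R[i]).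

(** The integral defining [singular_inner] is evaluated on the disc only; shrinking the radius to
    [(1 - |z|) / 2] keeps [z + h] there. *)
Lemma quad_derive_eq_disc f g z v : (forall x, modulus x < 1 -> f x = g x) ->
  modulus z < 1 -> quad_derive g z v -> quad_derive f z v.
Proof.
move=> fg z1 [C [r [C0 r0 H]]]; exists C, (Num.min r ((1 - modulus z) / 2)).
split=> //; first by rewrite lt_min r0 divr_gt0// subr_gt0.
move=> h; rewrite lt_min => /andP[hr hz].
by rewrite !fg//; [exact: H|exact: modulus_disc_shift hz].
Qed.

Lemma holomorphic_on_disc_quad f (df : R[i] -> R[i]) :
  (forall z, modulus z < 1 -> quad_derive f z (df z)) -> holomorphic_on_disc f.
Proof.
move=> H z /discE /H /quad_derive_is_derive h.
exact: (@ex_derive _ _ _ _ _ _ _ h).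
Qed.

Lemma cderive_quad f z v : quad_derive f z v -> cderive f z = v.
Proof. by move=> /quad_derive_is_derive h; exact: (@derive_val _ _ _ _ _ _ _ h). Qed.

End HolomorphicOnDisc.

Theorem theorem10p3 (R : realType) (s : R) (hs : 0 < s < 1)
    (a : nat -> {posnum R})
    (ha : cvgn (series (fun n => (a n)%:num `^ s)))
    (lambda : nat -> R[i]) (hlambda : forall n, circle (lambda n)) :
  exists g : R[i] -> R[i],
    [/\ H2 g,
        exists2 z, disc z & g z != 0
      & Ds s (fun z => singular_inner (atomic_measure a lambda) z * g z)].
Proof.
pose a' n := (a n)%:num.
have a0 n : 0 < a' n by rewrite /a'.
have l1 n : modulus (lambda n) = 1 by exact/circleE.
have ca : cvgn (series a') by exact: summable_of_powR hs a0 ha.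
pose f z := singular_inner (atomic_measure a lambda) z * zprod a' lambda z.
have fE z : modulus z < 1 -> f z = inner_zprod a' lambda z.
  move=> z1; rewrite /f /inner_zprod; congr (_ * _).
  by rewrite /singular_inner circle_integral_atomic_measure.
have df z : modulus z < 1 -> quad_derive f z (dinner_zprod a' lambda z).
  by move=> z1; apply: (quad_derive_eq_disc fE z1); exact: quad_derive_inner_zprod.
exists (zprod a' lambda); split.
- split.
    by apply: holomorphic_on_disc_quad => z z1; exact: quad_derive_zprod.
  apply: (@H2_sqnorm_bounded _ _ 1) => z z1; exact: modulus_zprod_le1.
- exists 0; first by apply/discE; rewrite modulus0.
  exact: zprod0_neq0.
split; first exact: holomorphic_on_disc_quad df.
rewrite /Ds_sqnorm; apply: lte_add_pinfty.
  apply: (@H2_sqnorm_bounded _ _ (expR (limn (series a')))) => z z1.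
  rewrite -/(f z) fE// /inner_zprod modulusM -[leRHS]mulr1; apply: ler_pM.
  - exact: modulus_ge0.
  - exact: modulus_ge0.
  - exact: modulus_expG_le1.
  - exact: modulus_zprod_le1.
pose K : R := 9 * expR (2 * limn (series a')).
have K0 : 0 <= K by rewrite mulr_ge0// expR_ge0.
pose wk n (p : R * R) : R := (1 - modulus (of_plane p) ^+ 2) `^ s *
  pole_kernel (a' n) (lambda n) (of_plane p).
have wk0 n p : disc_plane p -> 0 <= wk n p.
  move=> /discE z1; rewrite mulr_ge0 ?powR_ge0//.
  exact: (pole_kernel_ge0 a' l1 z1 n).
apply: (@le_lt_trans _ _ (pi^-1%:E * \sum_(n <oo)
   (K * dyadic_const s * a' n `^ s)%:E)%E).
  rewrite lee_wpmul2l ?lee_fin ?invr_ge0 ?pi_ge0//.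
  (* The bound [|f'|^2 <= K W] is written as a series of nonnegative functions, so that sum and
     integral can be exchanged. *)
  apply: (@le_trans _ _ (\int[(@lebesgue_measure R \x @lebesgue_measure R)%E]_(p in
      disc_plane) (\sum_(n <oo) (K * a' n * wk n p)%:E))%E).
    apply: ge0_le_integral_nomeasurable => p Dp.
      by rewrite lee_fin mulr_ge0 ?sqr_ge0 ?powR_ge0.
    have /discE z1 := Dp; set z := of_plane p in z1 *.
    have c := cvgn_W a0 l1 ca z1.
    have E : series (fun n => K * a' n * wk n p) = (fun N =>
        K * (1 - modulus z ^+ 2) `^ s *
        series (fun n => a' n * pole_kernel (a' n) (lambda n) z) N).
      apply/funext => N; rewrite /series/= mulr_sumr; apply: eq_bigr => n _.
      by rewrite /wk -/z; ring.
    have cE : series (fun n => K * a' n * wk n p) @ \oo -->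
        K * (1 - modulus z ^+ 2) `^ s * sumW a' lambda z.
      by rewrite E; apply: cvgMr; exact: c.
    rewrite nneseries_EFin; last exact: cvgP cE.
    rewrite (cvg_lim _ cE)// lee_fin (cderive_quad (df z z1)).
    rewrite [leRHS]mulrAC ler_wpM2r ?powR_ge0//.
    exact: sqr_modulus_dinner_zprod_le.
  rewrite integral_nneseries//=; last 3 first.
  - exact: measurable_disc_plane.
  - move=> n; apply/measurable_EFinP; apply: measurable_funM => //.
    exact: measurable_weighted_kernel.
  - by move=> n p Dp; rewrite lee_fin mulr_ge0 ?wk0// mulr_ge0// ltW.
  apply: lee_nneseries => [n _ _|n _].
    by apply: integral_ge0 => p Dp; rewrite lee_fin mulr_ge0 ?wk0// mulr_ge0// ltW.
  under eq_integral do rewrite EFinM.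
  have Ka : 0 <= K * a' n by rewrite mulr_ge0// ltW.
  rewrite ge0_integralZl ?lee_fin//=; last 3 first.
  - exact: measurable_disc_plane.
  - by apply/measurable_EFinP; exact: measurable_weighted_kernel.
  - by move=> p Dp; rewrite lee_fin wk0.
  apply: (le_trans (lee_wpmul2l _ (integral_weighted_kernel_le hs (a0 n) (l1 n)))).
    by rewrite lee_fin.
  (* The coefficient [a' n] cancels the denominator of [a' n ^ s / a' n], leaving the summable
     power. *)
  rewrite -EFinM lee_fin le_eqVlt; apply/orP; left; apply/eqP; field.
  by rewrite gt_eqF.
have cs : series (fun n => K * dyadic_const s * a' n `^ s) @ \oo -->
    K * dyadic_const s * limn (series (fun n => a' n `^ s)).
  rewrite (_ : series _ = (fun N => K * dyadic_const s * series (fun n => a' n `^ s) N)).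
    by apply: cvgMr; exact: ha.
  by apply/funext => N; rewrite /series/= mulr_sumr.
by rewrite nneseries_EFin; [rewrite -EFinM ltry|exact: cvgP cs].
Qed.
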